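(* Let $(W,S)$ and $(W',S)$ be finite, simply laced Coxeter systems with the same set $S$ of simple generators such that the Coxeter diagram of $W'$ is obtained from the Coxeter diagram of $W$ by erasing a set $E$ of edges. Then the edge-erasing homomorphism $\eta_E$ is the unique compressive homomorphism from the weak order on $W$ to the weak order on $W'$ fixing $S$ pointwise.
   Context: For a finite Coxeter system $(W,S)$ with length function $\ell$, the (right) weak order on $W$ is the lattice whose cover relations are $w\lessdot ws$ for $w\in W$, $s\in S$ with $\ell(w)<\ell(ws)$. A lattice homomorphism preserves pairwise meets and joins; a homomorphism of finite lattices is compressive if it is surjective and restricts to a bijection between the sets of atoms (elements covering the minimum; for the weak order these are the elements of $S$). The Coxeter diagram has vertex set $S$ and an edge joining $r\neq s$ whenever the order $m(r,s)$ of $rs$ is at least $3$; the system is simply laced if $m(r,s)\le 3$ for all $r,s\in S$. The diagram of a finite Coxeter group is a forest. For $J\subseteq S$ and $w\in W$, there is a unique factorization $w=w_J\cdot{}^Jw$ maximizing $\ell(w_J)$ subject to $\ell(w_J)+\ell({}^Jw)=\ell(w)$ and $w_J\in W_J$, where $W_J$ is the subgroup generated by $J$. Given a set $E$ of edges of the diagram of $W$, let $J_1,\dots,J_k$ be the vertex sets of the connected components of the graph obtained by deleting the edges $E$ from the diagram. The edge-erasing homomorphism is $\eta_E:W\to W_{J_1}\times\cdots\times W_{J_k}$, $w\mapsto(w_{J_1},\dots,w_{J_k})$; here $W_{J_1}\times\cdots\times W_{J_k}$ is identified with $W'$ (with simple generators $S$). *)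

(* Defs.v *)
From mathcomp Require Import all_boot all_order all_fingroup.

Set Implicit Arguments.
Unset Strict Implicit.
Unset Printing Implicit Defensive.

Local Open Scope group_scope.

Section FinitePosets.

Variables (T : finType) (le : rel T).

Definition is_meet (x y z : T) : Prop :=
  [/\ le z x, le z y & forall t, le t x -> le t y -> le t z].

Definition is_join (x y z : T) : Prop :=
  [/\ le x z, le y z & forall t, le x t -> le y t -> le z t].

Definition covers (x y : T) : bool :=
  [&& x != y, le x y & [forall z, le x z && le z y ==> (z == x) || (z == y)]].

Definition atoms : {set T} :=
  [set a | [exists b, [forall x, le b x] && covers b a]].

End FinitePosets.

(* When (T, le) and (U, le') are lattices, the meet (join) of x and y is the
   only z with is_meet le x y z (is_join le x y z), so this says that f commutes
   with the binary meet and join operations. *)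
Definition lattice_hom (T U : finType) (le : rel T) (le' : rel U)
    (f : T -> U) : Prop :=
  (forall x y z, is_meet le x y z -> is_meet le' (f x) (f y) (f z)) /\
  (forall x y z, is_join le x y z -> is_join le' (f x) (f y) (f z)).

Definition compressive (T U : finType) (le : rel T) (le' : rel U)
    (f : T -> U) : Prop :=
  [/\ lattice_hom le le' f,
      forall u, exists t, f t = u,
      {in atoms le &, injective f}
    & [set f a | a in atoms le] = atoms le'].

(* A finite Coxeter system whose set of simple generators is indexed by S.  As in
   Bourbaki, the generators are distinct elements of order 2, and W is presented
   by them subject to the relations (rs)^m(r,s) = 1, with m(r,s) the order of rs.
   The last field is the universal property of that presentation, with the target
   H ranging over all groups, finite or not. *)
Record coxeter_system (S : finType) := CoxeterSystem {
  cox_group :> finGroupType;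
  cox_gen : S -> cox_group;
  cox_gen_inj : injective cox_gen;
  cox_gen_order : forall s, #[cox_gen s] = 2;
  cox_gen_full : <<cox_gen @: [set: S]>> = [set: cox_group];
  cox_presented : forall (H : groupType) (f : S -> H),
    (forall r s, (f r * f s) ^+ #[cox_gen r * cox_gen s] = 1) ->
    exists phi : {multiplicative cox_group -> H},
      forall s, phi (cox_gen s) = f s
}.

Section CoxeterSystem.

Variables (S : finType) (W : coxeter_system S).

Definition cox_m (r s : S) : nat := #[cox_gen W r * cox_gen W s].

Definition simply_laced : Prop := forall r s, cox_m r s <= 3.

Definition diagram : {set {set S}} :=
  [set e | [exists r, exists s,
    [&& e == [set r; s], r != s & 3 <= cox_m r s]]].

Definition eval_word (t : seq S) : W := \prod_(s <- t) cox_gen W s.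

Definition parabolic (J : {set S}) : {group W} :=
  <<[set cox_gen W s | s in J]>>%G.

Lemma parabolic_word (J : {set S}) (w : W) : w \in parabolic J ->
  exists t : seq S, all (mem J) t && (eval_word t == w).
Proof.
case/gen_prodgP=> n [c cJ ->]; elim: n c cJ => [|n IHn] c cJ.
  by exists [::]; rewrite /eval_word big_nil big_ord0 /=.
have [|t /andP[tJ /eqP tE]] := IHn (fun i => c (lift ord0 i)).
  by move=> i; apply: cJ.
have /imsetP[s sJ cE] := cJ ord0.
exists (s :: t); rewrite /= tJ andbT; apply/andP; split; first exact: sJ.
by rewrite /eval_word big_cons big_ord_recl -cE -tE.
Qed.

Lemma word_length (w : W) :
  exists n, [exists t : n.-tuple S, eval_word t == w].
Proof.
have [|t /andP[_ tw]] := @parabolic_word [set: S] w.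
  by rewrite /= cox_gen_full inE.
by exists (size t); apply/existsP; exists (in_tuple t).
Qed.

Definition cox_length (w : W) : nat := ex_minn (word_length w).

Definition weak_order : rel W :=
  connect [rel w v | [exists s, (v == w * cox_gen W s) &&
                                (cox_length w < cox_length v)]].

(* w_J : it determines the other factor, u^-1 * w, of the factorization. *)
Definition parabolic_part (J : {set S}) (w : W) : W :=
  [arg max_(u > 1 | (u \in parabolic J) &&
     (cox_length u + cox_length (u^-1 * w) == cox_length w)) cox_length u].

Lemma parabolic_part_in (J : {set S}) (w : W) :
  parabolic_part J w \in parabolic J.
Proof.
rewrite /parabolic_part; case: arg_maxnP => [|u /andP[] //].
rewrite group1 invg1 mul1g /= -[X in _ == X]add0n eqn_add2r -leqn0.
rewrite /cox_length; case: ex_minnP => n _; apply.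
by apply/existsP; exists [tuple]; rewrite /eval_word big_nil.
Qed.

Variable E : {set {set S}}.

(* The vertex sets J_1, ..., J_k of the components of the diagram without E. *)
Definition erased_components : {set {set S}} :=
  [set [set s | connect [rel a b | [set a; b] \in diagram :\: E] r s] | r : S].

Definition component : finType := {J : {set S} | J \in erased_components}.

(* The external direct product of W_(J_1), ..., W_(J_k). *)
Definition parabolic_product : finGroupType :=
  {dffun forall J : component, [subg parabolic (val J)]}.

Definition parabolic_parts (w : W) : parabolic_product :=
  [ffun J : component => Subg (parabolic_part_in (val J) w)].

End CoxeterSystem.

Arguments weak_order {S} W _ _.

Section EdgeErasing.

Variables (S : finType) (W W' : coxeter_system S) (E : {set {set S}}).

(* The identification of W_J with the subgroup W'_J of W': spell an element of
   W_J as a word in the letters of J, and read that word in W'.  For J a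
   component of the erased diagram, the result is independent of the word. *)
Definition respell (J : {set S}) (u : [subg parabolic W J]) : W' :=
  eval_word W' (xchoose (parabolic_word (subgP u))).

(* The resulting identification of the product of the W_J with W'. *)
Definition product_ident (x : parabolic_product W E) : W' :=
  \prod_(J : component W E) respell (x J).

Definition edge_erasing (w : W) : W' := product_ident (parabolic_parts E w).

Definition product_gen (J : component W E) (s : S) : parabolic_product W E :=
  [ffun K => if K == J then subg (parabolic W (val K)) (cox_gen W s) else 1].

Lemma prod_ffunE (I : Type) (r : seq I) (F : I -> parabolic_product W E) K :
  (\prod_(i <- r) F i) K = \prod_(i <- r) F i K.
Proof. by elim/big_rec2: _ => [|i a b _ <-]; rewrite ffunE. Qed.

(* product_ident is the only possible identification: any homomorphism
   from the product to W' that fixes S pointwise is equal to it. *)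
Lemma product_ident_unique (phi : {multiplicative parabolic_product W E -> W'}) :
  (forall (J : component W E) s, s \in val J ->
     phi (product_gen J s) = cox_gen W' s) ->
  product_ident =1 phi.
Proof.
move=> phiS x.
have phiM : {morph phi : a b / a * b} by move=> a b; exact: gmulfM.
have phi1 : phi 1 = 1 by apply: (mulgI (phi 1)); rewrite -phiM !mulg1.
pose e J : parabolic_product W E :=
  [ffun K => if K == J then x K else 1].
have xE : x = \prod_J e J.
  apply/ffunP => K; rewrite prod_ffunE.
  have -> : \prod_J e J K = \prod_(J | J == K) x K.
    rewrite [RHS]big_mkcond; apply: eq_bigr => J _.
    by rewrite ffunE eq_sym.
  by rewrite big_pred1_eq.
rewrite [in RHS]xE (big_morph phi phiM phi1); apply: eq_bigr => J _.
rewrite /respell.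
have /andP[/allP tJ /eqP tE] :=
  xchooseP (parabolic_word (subgP (x J))).
set t := xchoose _ in tJ tE *.
have -> : e J = \prod_(s <- t) product_gen J s.
  apply/ffunP => K; rewrite prod_ffunE ffunE.
  under eq_bigr => s _ do rewrite ffunE.
  case: eqP => [->|_]; last by rewrite big1_eq.
  apply: val_inj; rewrite /= -tE /eval_word.
  rewrite (big_morph sgval (id1 := 1) (op1 := mulg)) //.
  apply: eq_big_seq => s /tJ sJ.
  by rewrite subgK // mem_gen // imset_f.
rewrite (big_morph phi phiM phi1); apply: eq_big_seq => s /tJ sJ.
by rewrite phiS.
Qed.

End EdgeErasing.

(* Main.v *)
(* An element w is encoded by its set N(w) of left inversions: weak order is
   inclusion of these sets, and N(w_J) is the intersection of N(w) and W_J.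
   Finiteness of W makes its diagram a forest, so no erased edge joins two
   elements of one component J; hence m = m' on J, and by Matsumoto's theorem
   respelling words gives an isomorphism theta_J from W_J to W'_J.  The
   J-component of eta_E(w) is theta_J(w_J), and w |-> w_J is a lattice
   homomorphism: it preserves joins because (R \ W_J) U N(t) is the inversion set
   of some element for every t in W_J.

   For uniqueness, f maps w_J, the meet of w with the longest element of W_J, to
   f(w)_J, and so restricts to a bijection from W_J to W'_J.  By induction on
   length it agrees there with theta_J: if zr and zs lie above z, then f is known
   at the join z w_0(r,s) of zr and zs, and if m(r,s) = 3 then f(zrs) lies
   strictly between f(zr) and f(z w_0(r,s)), which leaves one possibility. *)
Require Import Defs.
From mathcomp Require Import all_boot all_order all_fingroup all_algebra cyclic zify ring.

Set Implicit Arguments.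
Unset Strict Implicit.
Unset Printing Implicit Defensive.

Local Open Scope group_scope.

(** * Left inversion sets and their relation to weak order *)

Section Inversions.

Variables (S : finType) (W : coxeter_system S).
Notation g := (cox_gen W).
Notation eval := (eval_word W).
Notation len := (@cox_length S W).

Lemma gen_sq s : g s * g s = 1.
Proof. by rewrite -(expg_order (g s)) cox_gen_order expgS expg1. Qed.

Lemma genV s : (g s)^-1 = g s.
Proof. by apply/eqP; rewrite eq_invg_mul gen_sq. Qed.

Lemma genK s (x : W) : g s * (g s * x) = x.
Proof. by rewrite mulgA gen_sq mul1g. Qed.

Lemma conj_genK s (x : W) : (x ^ g s) ^ g s = x.
Proof. by rewrite -conjgM gen_sq conjg1. Qed.

Lemma conj_gen_eq s (x y : W) : (x ^ g s == y) = (x == y ^ g s).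
Proof. by rewrite -(inj_eq (conjg_inj (g s))) conj_genK. Qed.

Lemma eval_nil : eval [::] = 1.
Proof. by rewrite /eval_word big_nil. Qed.

Lemma eval_cons s a : eval (s :: a) = g s * eval a.
Proof. by rewrite /eval_word big_cons. Qed.

Lemma eval_cat a b : eval (a ++ b) = eval a * eval b.
Proof. by rewrite /eval_word big_cat. Qed.

Lemma eval_rcons a s : eval (rcons a s) = eval a * g s.
Proof. by rewrite -cats1 eval_cat eval_cons eval_nil mulg1. Qed.

(* The reflections s_1 ... s_(i-1) s_i s_(i-1) ... s_1. *)
Fixpoint refls (a : seq S) : seq W :=
  if a is s :: a' then g s :: [seq x ^ g s | x <- refls a'] else [::].

Lemma size_refls a : size (refls a) = size a.
Proof. by elim: a => //= s a <-; rewrite size_map. Qed.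

Lemma count_conj t s (l : seq W) :
  count_mem t [seq x ^ g s | x <- l] = count_mem (t ^ g s) l.
Proof.
rewrite count_map; apply: eq_count => x /=.
by rewrite conj_gen_eq.
Qed.

(** Bourbaki's signed action of a generator on reflections, taken on all of [W]; the boolean is the
    sign. *)
Definition flip s (p : W * bool) := (p.1 ^ g s, p.2 (+) (p.1 == g s)).

Lemma flip_inj s : injective (flip s).
Proof.
apply: inv_inj => -[t b]; rewrite /flip /= conj_genK -addbA.
by rewrite conj_gen_eq conjgE mulKg addbb addbF.
Qed.

Definition flip_perm s := perm (@flip_inj s).

Lemma flip_word a t b :
  (\prod_(s <- a) flip_perm s) (t, b) =
  (t ^ eval a, b (+) odd (count_mem t (refls a))).
Proof.
elim: a t b => [|s a IHa] t b; first by rewrite big_nil perm1 eval_nil conjg1 addbF.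
rewrite big_cons permM permE /flip IHa /= eval_cons conjgM count_conj oddD.
by rewrite oddb addbA (eq_sym t).
Qed.

Lemma refls_alternating r s n :
  refls (flatten (nseq n [:: r; s])) =
  [seq (g r * g s) ^+ i * g r | i <- iota 0 n.*2].
Proof.
elim: n => //= n ->; rewrite !conjgE genV expg0 mul1g expg1 -mulgA; congr [:: _, _ & _].
rewrite (iotaDl 2 0) -!map_comp; apply: eq_map => i /=.
by rewrite !conjgE !genV (expgS _ i.+1) expgSr !mulgA.
Qed.

(** The reflections of the word [(rs)^m] are [(rs)^i r] for [i < 2m]. As [(rs)^m = 1], this list is
    one block repeated twice, so every count is even and no sign changes. *)
Lemma flip_relation r s :
  (flip_perm r * flip_perm s) ^+ #[g r * g s] = 1.
Proof.
set m := #[_].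
have E n : (flip_perm r * flip_perm s) ^+ n =
           \prod_(x <- flatten (nseq n [:: r; s])) flip_perm x.
  by elim: n => [|n IHn]; rewrite ?big_nil // expgS IHn /= !big_cons mulgA.
have Ee n : (g r * g s) ^+ n = eval (flatten (nseq n [:: r; s])).
  by elim: n => [|n IHn]; rewrite ?eval_nil // expgS IHn /= !eval_cons mulgA.
apply/permP => -[t b]; rewrite E flip_word -Ee expg_order conjg1 perm1.
rewrite refls_alternating -addnn iotaD map_cat count_cat (addnC 0 m).
rewrite iotaDl -map_comp.
rewrite (@eq_map _ _ (_ \o addn m) (fun i => (g r * g s) ^+ i * g r)).
  by rewrite addnn odd_double addbF.
by move=> i /=; rewrite expgD expg_order mul1g.
Qed.

(** By [flip_relation] the presentation extends [flip_perm] to all of [W], and the sign computed in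
    [flip_word] is the parity in question. *)
Lemma refls_parity a b t : eval a = eval b ->
  odd (count_mem t (refls a)) = odd (count_mem t (refls b)).
Proof.
move=> ab; have [phi phiE] := cox_presented flip_relation.
have phi1 : phi 1 = 1 by apply: (mulgI (phi 1)); rewrite -gmulfM !mulg1.
have phiw c : phi (eval c) = \prod_(s <- c) flip_perm s.
  elim: c => [|s c IHc]; first by rewrite eval_nil phi1 big_nil.
  by rewrite eval_cons gmulfM IHc phiE big_cons.
have := flip_word a t false; rewrite -phiw ab phiw flip_word.
by case.
Qed.

Lemma word_exists (w : W) : exists a, eval a == w.
Proof.
have [|a /andP[_ aw]] := @parabolic_word _ W [set: S] w; last by exists a.
by rewrite /= cox_gen_full inE.
Qed.

(** By [refls_parity] the chosen word does not matter, and it need not be reduced. *)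
Definition inversions (w : W) : {set W} :=
  locked [set t | odd (count_mem t (refls (xchoose (word_exists w))))].

Notation N := inversions.

Lemma in_inversions a t : (t \in N (eval a)) = odd (count_mem t (refls a)).
Proof. by rewrite /inversions -lock inE; apply: refls_parity; exact/eqP/(xchooseP (word_exists _)). Qed.

Lemma evalP (w : W) : exists a, w = eval a.
Proof. by have [a /eqP] := word_exists w; exists a. Qed.

Lemma in_inv1 t : (t \in N 1) = false.
Proof. by rewrite -eval_nil in_inversions. Qed.

Lemma in_inv_gen s t : (t \in N (g s)) = (t == g s).
Proof.
rewrite -[g s]mulg1 -eval_nil -eval_cons in_inversions /= addn0 oddb eq_sym.
by rewrite eval_cons eval_nil mulg1.
Qed.

(** The cocycle identity: [N (v * w)] is the symmetric difference of [N v] and [v (N w) v^-1],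
    because the reflections of a concatenation are those of the first word followed by conjugates of
    those of the second. *)
Lemma in_invM v w t : (t \in N (v * w)) = (t \in N v) (+) (t ^ v \in N w).
Proof.
have [[a ->] [b ->]] := (evalP v, evalP w).
rewrite -eval_cat !in_inversions.
elim: a t => [|s a IHa] t /=; first by rewrite eval_nil conjg1.
by rewrite !count_conj !oddD IHa eval_cons conjgM addbA.
Qed.

Lemma in_invV v t : (t \in N v^-1) = (t ^ v^-1 \in N v).
Proof.
by have := in_invM v^-1 v t; rewrite mulVg in_inv1; do 2!case: (_ \in _).
Qed.

Lemma in_inv_gens s w t : (t \in N (w * g s)) = (t \in N w) (+) (t == g s ^ w^-1).
Proof. by rewrite in_invM in_inv_gen -(inj_eq (conjg_inj w^-1)) conjgK. Qed.

Lemma gen_inv_gens s w : (g s \in N (g s * w)) = (g s \notin N w).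
Proof. by rewrite in_invM in_inv_gen eqxx conjgE mulKg. Qed.

(** Strong exchange: deleting the letter at which [t] arises multiplies the value on the left by
    [t]. *)
Lemma refls_deletion a t : t \in refls a ->
  exists b, [/\ {subset b <= a}, size b < size a & eval b = t * eval a].
Proof.
elim: a t => // s a IHa t; rewrite inE => /orP[/eqP->|/mapP[x /IHa[b [ba sb be]] ->]].
  exists a; split=> //; last by rewrite eval_cons genK.
  by move=> x xa; rewrite inE xa orbT.
exists (s :: b); split=> //; last by rewrite !eval_cons be conjgE genV -!mulgA genK.
by move=> y; rewrite !inE => /orP[->//|/ba ->]; rewrite orbT.
Qed.

Lemma refls_not_uniq a : ~~ uniq (refls a) ->
  exists b, [/\ {subset b <= a}, size b < size a & eval b = eval a].
Proof.
elim: a => //= s a IHa; rewrite negb_and negbK map_inj_uniq; last exact: conjg_inj.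
case/orP=> [/mapP[x xa sx]|/IHa[b [ba sb be]]].
  (* The reflection [g s] arises again in the tail, so deletion there gives a word for
     [g s * eval a], the value of the whole word. *)
  have {sx} sx : x = g s by rewrite -[x](@conj_genK s) -sx conjgE mulKg.
  have [b [ba sb be]] := refls_deletion xa.
  exists b; split; [|by apply: ltnW|by rewrite be sx eval_cons].
  by move=> y /ba ya; rewrite inE ya orbT.
exists (s :: b); split=> //; last by rewrite !eval_cons be.
by move=> y; rewrite !inE => /orP[->//|/ba ->]; rewrite orbT.
Qed.

Lemma inversions_refls a : uniq (refls a) -> N (eval a) =i refls a.
Proof. by move=> ua t; rewrite in_inversions count_uniq_mem // oddb. Qed.

Lemma mem_inversions_refls a t : t \in N (eval a) -> t \in refls a.
Proof.
rewrite in_inversions => ot; rewrite -has_pred1 has_count.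
by case: count ot.
Qed.

Lemma len_word a : len (eval a) <= size a.
Proof.
rewrite /cox_length; case: ex_minnP => n _; apply.
by apply/existsP; exists (in_tuple a).
Qed.

Lemma reduced_exists w : exists2 a, w = eval a & size a = len w.
Proof.
rewrite /cox_length; case: ex_minnP => n /existsP[a /eqP <-] _.
by exists a; rewrite ?size_tuple.
Qed.

Lemma reduced_uniq a : size a = len (eval a) -> uniq (refls a).
Proof.
move=> ra; apply: contraT => /refls_not_uniq[b [_ sb be]].
by have := leq_trans sb (eq_leq ra); rewrite -be ltnNge len_word.
Qed.

Lemma card_inversions_uniq a : uniq (refls a) -> #|N (eval a)| = size a.
Proof.
move=> ua; rewrite -size_refls -(card_uniqP ua).
exact/eq_card/inversions_refls.
Qed.

Lemma card_inversions w : #|N w| = len w.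
Proof.
by have [a -> ra] := reduced_exists w; rewrite card_inversions_uniq ?reduced_uniq.
Qed.

Lemma inversions_eq0 w : (N w == set0) = (w == 1).
Proof.
apply/eqP/eqP => [N0|->]; last by apply/setP => t; rewrite in_inv1 inE.
have [a wa /eqP] := reduced_exists w.
by rewrite -card_inversions N0 cards0 wa => /nilP ->; rewrite eval_nil.
Qed.

Lemma inversions_inj : injective N.
Proof.
move=> u v uv; apply/eqP; rewrite eq_mulVg1 -inversions_eq0.
by apply/eqP/setP => t; rewrite in_invM -uv -in_invM mulVg in_inv1 inE.
Qed.

Lemma in_inv_mulV u v t : (t \in N (u^-1 * v)) = (t ^ u^-1 \in N u) (+) (t ^ u^-1 \in N v).
Proof. by rewrite in_invM in_invV. Qed.

Lemma inv_mulV u v : N u \subset N v -> N (u^-1 * v) = (N v :\: N u) :^ u.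
Proof.
move=> /subsetP uv; apply/setP => t.
rewrite in_inv_mulV mem_conjg inE.
by have := uv (t ^ u^-1); case: (t ^ u^-1 \in N u); case: (t ^ u^-1 \in N v) => // /(_ isT).
Qed.

(** By the cocycle identity [N (u^-1 * v)] is a conjugate of the symmetric difference of [N u] and
    [N v]. Its cardinality is [len v - len u] exactly when [N u :\: N v] is empty. *)
Lemma subset_inv_len u v :
  (N u \subset N v) = (len u + len (u^-1 * v) == len v).
Proof.
apply/idP/eqP => [uv|].
  rewrite -!card_inversions inv_mulV // cardJg -(cardsID (N u) (N v)).
  by rewrite (setIidPr uv).
rewrite -!card_inversions => E; apply: contraT => nuv.
have /eqP: N (u^-1 * v) = ((N u :\: N v) :|: (N v :\: N u)) :^ u.
  apply/setP => t; rewrite in_inv_mulV mem_conjg !inE.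
  by case: (_ \in N u); case: (_ \in N v).
move=> /eqP E'; move: E; rewrite E' cardJg cardsU.
have -> : (N u :\: N v) :&: (N v :\: N u) = set0.
  by apply/setP => t; rewrite !inE; case: (t \in N u); rewrite ?andbF.
rewrite cards0 subn0 => E.
have := cardsID (N v) (N u); have := cardsID (N u) (N v); rewrite (setIC (N v)).
have : 0 < #|N u :\: N v| by rewrite card_gt0 setD_eq0.
by move: E; set a := #|_|; set b := #|_ :&: _|; set c := #|_ :\: _|; set d := #|_|; lia.
Qed.

Lemma weak_orderE u v : weak_order W u v = (N u \subset N v).
Proof.
apply/idP/idP.
  case/connectP=> p; elim: p u => [|w p IHp] u /= => [_ ->|/andP[]] //.
  case/existsP=> s /andP[/eqP -> us] /IHp H /H; apply: subset_trans.
  (* [N (u * g s)] and [N u] differ only in [g s ^ u^-1]; if that were an inversion of [u], the step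
     would go down. *)
  rewrite -!card_inversions in us; apply/subsetP => t tu; rewrite in_inv_gens tu.
  apply: contraL us => /=; rewrite -leqNgt => /eqP tE; apply/subset_leq_card.
  by apply/subsetP => x; rewrite in_inv_gens -tE; case: eqP => [->|]; rewrite ?addbF.
have [a aE] := reduced_exists (u^-1 * v).
rewrite subset_inv_len => sa /eqP uv; move: sa uv aE => <-.
(* Induction on a word for [u^-1 * v] whose size is the difference of lengths: [le1] and [le2]
   together force the last letter to be an ascent. *)
have [n] := ubnP (size a); elim: n => // n IHn in a v * => san uv vE.
case: (lastP a) => [|b s] in san uv vE *.
  rewrite -[v](mulKVg u) vE eval_nil mulg1; exact: connect0.
rewrite size_rcons in san uv.
have vE' : v = u * eval b * g s by rewrite -mulgA -eval_rcons -vE mulKVg.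
have le1 : len v <= (len (u * eval b)).+1.
  have [c cE <-] := reduced_exists (u * eval b).
  by rewrite vE' cE -eval_rcons -(size_rcons c s) len_word.
have le2 : len (u * eval b) <= len u + size b.
  have [c -> <-] := reduced_exists u.
  by rewrite -eval_cat -size_cat len_word.
apply: connect_trans (IHn b (u * eval b) _ _ _) (connect1 _).
- by [].
- by lia.
- by rewrite mulKg.
by apply/existsP; exists s; rewrite -vE' eqxx; lia.
Qed.

End Inversions.

(** * Parabolic subgroups, longest elements and existence of meets *)

Section Parabolic.

Variables (S : finType) (W : coxeter_system S).
Notation g := (cox_gen W).
Notation eval := (eval_word W).
Notation len := (@cox_length S W).
Notation N := (@inversions S W).
Notation par := (parabolic W).

Implicit Types (J : {set S}) (w x y z u v t : W).

Lemma gen_par J s : s \in J -> g s \in par J.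
Proof. by move=> sJ; apply/mem_gen/imset_f. Qed.

Lemma eval_par J a : {subset a <= J} -> eval a \in par J.
Proof.
elim: a => [|s a IHa] aJ; first by rewrite eval_nil group1.
rewrite eval_cons groupM ?gen_par ?aJ ?mem_head // IHa // => y ya.
by rewrite aJ // inE ya orbT.
Qed.

Lemma refls_par J a t : {subset a <= J} -> t \in refls W a -> t \in par J.
Proof.
move=> aJ /refls_deletion[b [/(_ _ _)/aJ-bJ _ be]].
have ->: t = eval b * (eval a)^-1 by rewrite be mulgK.
by rewrite groupM ?groupV ?eval_par.
Qed.

(** Deletion introduces no new letters, so a word in [J] shortens to a reduced one that is still in
    [J]. *)
Lemma reduced_par_word J w : w \in par J ->
  exists a, [/\ {subset a <= J}, eval a = w & uniq (refls W a)].
Proof.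
case/parabolic_word=> a /andP[/allP aJ /eqP <-]; move: {2}(size a).+1 (ltnSn (size a)) => n.
elim: n a aJ => // n IHn a aJ san.
have [ua|/refls_not_uniq[b [ba sb <-]]] := boolP (uniq (refls W a)); first by exists a.
by apply: IHn => [y /ba/aJ //|]; apply: leq_trans sb _.
Qed.

Lemma inversions_par J w : w \in par J -> N w \subset par J.
Proof.
case/reduced_par_word=> a [aJ <- ua]; apply/subsetP => t.
by move/mem_inversions_refls; apply: refls_par.
Qed.

Lemma par_inv_gen J w : w \in par J -> w != 1 -> exists2 s, s \in J & g s \in N w.
Proof.
case/reduced_par_word=> -[|s a] [aJ <- ua]; first by rewrite eval_nil eqxx.
by exists s; rewrite ?aJ ?mem_head // inversions_refls //= mem_head.
Qed.

Lemma inv_gen_exists w : w != 1 -> exists s, g s \in N w.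
Proof.
have wT : w \in par [set: S] by rewrite /= cox_gen_full inE.
by move=> /(par_inv_gen wT)[s _ sw]; exists s.
Qed.

Lemma gen_in_par J s : (g s \in par J) = (s \in J).
Proof.
apply/idP/idP; last exact: gen_par.
move=> sJ; have [|r rJ] := par_inv_gen sJ.
  by rewrite -inversions_eq0; apply/set0Pn; exists (g s); rewrite in_inv_gen.
by rewrite in_inv_gen => /eqP/cox_gen_inj <-.
Qed.

Definition reflections : {set W} :=
  locked [set t | [exists s, exists x, t == g s ^ x]].
Notation R := reflections.

Lemma reflP t : reflect (exists s x, t = g s ^ x) (t \in R).
Proof.
rewrite /reflections -lock inE; apply: (iffP existsP) => -[s].
  by case/existsP=> x /eqP ->; exists s, x.
by case=> x ->; exists s; apply/existsP; exists x.
Qed.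

Lemma reflJ t x : (t ^ x \in R) = (t \in R).
Proof.
suff H y z : y \in R -> y ^ z \in R by apply/idP/idP => [/(H _ x^-1)|/H //]; rewrite conjgK.
by case/reflP=> s [u ->]; apply/reflP; exists s, (u * z); rewrite conjgM.
Qed.

Lemma gen_refl s : g s \in R.
Proof. by apply/reflP; exists s, 1; rewrite conjg1. Qed.

Lemma refl_sq t : t \in R -> t * t = 1.
Proof. by case/reflP=> s [x ->]; rewrite -conjMg gen_sq conj1g. Qed.

Lemma reflV t : t \in R -> t^-1 = t.
Proof. by move=> tR; apply/eqP; rewrite eq_invg_mul refl_sq. Qed.

Lemma refl_inv t : t \in R -> t \in N t.
Proof.
case/reflP=> s [x ->]; rewrite {2}conjgE in_invM in_invV conjgK in_invM in_inv_gen eqxx.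
by rewrite conjgE mulKg; case: (_ \in _).
Qed.

Lemma inversions_reflections w : N w \subset R.
Proof.
have [a ->] := evalP w; apply/subsetP => t /mem_inversions_refls.
elim: a t => //= s a IHa t; rewrite inE => /orP[/eqP->|/mapP[x /IHa xR ->]].
  exact: gen_refl.
by rewrite reflJ.
Qed.

Lemma refl_mul_inv t w : t \in R -> (t \in N (t * w)) = (t \notin N w).
Proof. by move=> tR; rewrite in_invM refl_inv // conjgE mulKg. Qed.

Lemma inv_mul_lt t w : t \in N w -> len (t * w) < len w.
Proof.
have [a -> <-] := reduced_exists w => /mem_inversions_refls/refls_deletion[b [_ sb <-]].
exact: leq_ltn_trans (len_word _ _) sb.
Qed.

Definition longest : W := [arg max_(w > 1) len w].

(** If a reflection [t] were missing from [N w] for [w] of maximal length, then [t * w] would be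
    longer. *)
Lemma inversions_longest : N longest = R.
Proof.
apply/eqP; rewrite eqEsubset inversions_reflections; apply/subsetP => t tR.
rewrite /longest; case: arg_maxnP => // w _ /(_ (t * w) isT); apply: contraTT => tw.
by rewrite -ltnNge -{1}(mulKg t w) reflV // inv_mul_lt // refl_mul_inv.
Qed.

(** Choose [x] in [W_J] with [x^-1 * w] as short as possible. An inversion of [x^-1 * w] in [W_J]
    could be absorbed into [x], so there is none, and the cocycle identity gives [N x]. *)
Lemma par_factor J w : exists2 x, x \in par J & N x = N w :&: par J.
Proof.
case: (@arg_minnP _ 1 (mem (par J)) (fun x => len (x^-1 * w))); first exact: group1.
move=> x /= xJ xmin; exists x => //.
have vJ t : t \in par J -> t \notin N (x^-1 * w).
  move=> tJ; apply/negP => /inv_mul_lt; rewrite ltnNge => /negP[].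
  have -> : t * (x^-1 * w) = (x * t^-1)^-1 * w by rewrite invMg invgK mulgA.
  by rewrite xmin ?groupM ?groupV.
apply/setP => t; rewrite inE; have [tJ|tJ] := boolP (t \in par J).
  by rewrite -[w](mulKVg x) in_invM (negPf (vJ _ _)) ?addbF ?andbT // groupJ.
by rewrite andbF; apply/negP => /(subsetP (inversions_par xJ)); apply/negP.
Qed.

(** A maximizing [u] has [N u] inside [N w :&: par J] by [subset_inv_len]; the element from
    [par_factor] competes with it, so the cardinalities agree. *)
Lemma inversions_part J w : N (parabolic_part J w) = N w :&: par J.
Proof.
have [x xJ Nx] := par_factor J w.
rewrite /parabolic_part; case: arg_maxnP => [|u /andP[uJ]].
  by rewrite group1 -subset_inv_len (eqP (_ : N 1 == set0)) ?sub0set ?inversions_eq0.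
rewrite -subset_inv_len => uw umax; apply/eqP; rewrite eqEcard subsetI uw inversions_par //.
rewrite -Nx !card_inversions; apply: umax; rewrite xJ -subset_inv_len Nx.
exact: subsetIl.
Qed.

Lemma part_id J w : w \in par J -> parabolic_part J w = w.
Proof.
by move=> wJ; apply: inversions_inj; rewrite inversions_part (setIidPl _) ?inversions_par.
Qed.

Definition longest_par J := parabolic_part J longest.

Lemma longest_par_in J : longest_par J \in par J.
Proof. exact: parabolic_part_in. Qed.

Lemma inversions_longest_par J : N (longest_par J) = R :&: par J.
Proof. by rewrite inversions_part inversions_longest. Qed.

(** Multiplying [w_J] on the right by the inverse of the longest element of [W_J] complements its
    inversion set among the reflections of [W_J]. A nonempty complement would contain a generator
    from [J], by [par_inv_gen]. *)
Lemma gens_below J w : (forall s, s \in J -> g s \in N w) -> R :&: par J \subset N w.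
Proof.
move=> Jw; set x := parabolic_part J w.
have Nx := inversions_part J w; rewrite -/x in Nx.
have xJ : x \in par J := parabolic_part_in J w.
set y := x * (longest_par J)^-1.
have yJ : y \in par J by rewrite groupM ?groupV ?longest_par_in.
have xE t : t \in R :&: par J -> (t \in N x) = (t \notin N y).
  rewrite inE => /andP[tR tJ].
  have -> : x = y * longest_par J by rewrite mulgKV.
  by rewrite in_invM inversions_longest_par inE reflJ tR groupJ // addbT.
have [y1|/(par_inv_gen yJ)[s sJ sy]] := eqVneq y 1.
  apply/subsetP => t tR; have := xE t tR; rewrite y1 in_inv1 Nx inE.
  by case: (t \in N w).
have := xE (g s); rewrite inE gen_refl gen_par // sy => /(_ isT).
by rewrite Nx inE Jw // gen_par.
Qed.

Lemma longest_par_le J w :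
  (N (longest_par J) \subset N w) = [forall (s | s \in J), g s \in N w].
Proof.
rewrite inversions_longest_par; apply/idP/forall_inP => [Jw s sJ|]; last exact: gens_below.
by apply: (subsetP Jw); rewrite inE gen_refl gen_par.
Qed.

(** The element [(longest_par J)^-1 * longest] has inversion set [R :\: par J], which conjugation by
    [W_J] preserves; multiplying by [t] on the left adds [N t]. *)
Lemma par_bound J t : t \in par J -> exists u, N u = (R :\: par J) :|: N t.
Proof.
move=> tJ; exists (t * ((longest_par J)^-1 * longest)); apply/setP => x.
rewrite !inE in_invM in_inv_mulV inversions_longest_par inversions_longest inE !reflJ.
rewrite !groupJr ?groupV ?longest_par_in //.
have := subsetP (inversions_par tJ) x; have := subsetP (inversions_reflections t) x.
by do 3!case: (_ \in _) => //=; first [move=> _ /(_ isT) | move/(_ isT)].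
Qed.

(** Left multiplication by [g s] conjugates an inversion set and toggles [g s]. Here [g s] is an
    inversion of both elements; in [inv_shift_up], of neither. *)
Lemma inv_shift_down s u v : g s \in N u -> N u \subset N v ->
  N (g s * u) \subset N (g s * v).
Proof.
move=> su /subsetP uv; apply/subsetP => t; rewrite !in_invM !in_inv_gen.
by case: eqP => [->|_ /uv //]; rewrite conjgE mulKg su.
Qed.

Lemma inv_shift_up s u v : g s \notin N v -> N u \subset N v ->
  N (g s * u) \subset N (g s * v).
Proof.
move=> sv /subsetP uv; apply/subsetP => t; rewrite !in_invM !in_inv_gen.
by case: eqP => [->|_ /uv //]; rewrite conjgE mulKg (negPf sv).
Qed.

(* Bjorner: the greatest lower bounds of those lower bounds that lie above a
   given generator all coincide, as each of them lies above the join of the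
   generators below F. *)
Lemma glb_exists (F : {set W}) x : x \in F -> exists z,
  (forall y, y \in F -> N z \subset N y) /\
  (forall u, (forall y, y \in F -> N u \subset N y) -> N u \subset N z).
Proof.
have [n] := ubnP (len x); elim: n => // n IHn in F x * => xn xF.
pose A := [set s | [forall (y | y \in F), g s \in N y]].
have inA s y : s \in A -> y \in F -> g s \in N y.
  by rewrite inE => /forall_inP; apply.
have lbA u : (forall y, y \in F -> N u \subset N y) ->
    u = 1 \/ exists2 s, s \in A & g s \in N u.
  move=> uF; have [->|/inv_gen_exists[s su]] := eqVneq u 1; [by left | right].
  by exists s => //; rewrite inE; apply/forall_inP => y /uF/subsetP/(_ _ su).
have le1 v : N 1 \subset N v.
  by apply/subsetP => t; rewrite in_inv1.
have [A0|[s0 s0A]] := set_0Vmem A.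
  exists 1; split=> // u /lbA[->//|[s]].
  by rewrite A0 inE.
(* Left multiplication by [g s] turns [F] into a set containing the shorter element [g s * x]. A
   greatest lower bound there, multiplied back, is greatest among the lower bounds of [F] above
   [g s]. *)
have H s : s \in A -> exists z, [/\ forall y, y \in F -> N z \subset N y, g s \in N z &
    forall u, (forall y, y \in F -> N u \subset N y) -> g s \in N u -> N u \subset N z].
  move=> sA; have [||z' [z'lb z'max]] := IHn [set g s * y | y in F] (g s * x).
  - exact: leq_trans (inv_mul_lt (inA _ _ sA xF)) xn.
  - exact: imset_f.
  have sz' : g s \notin N z'.
    have /subsetP/(_ (g s))/contra := z'lb _ (imset_f _ xF); apply.
    by rewrite gen_inv_gens negbK inA.
  exists (g s * z'); split; last 2 first.
  - by rewrite gen_inv_gens.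
  - move=> u uF su; rewrite -(genK s u) inv_shift_up // z'max // => y /imsetP[y' y'F ->].
    by rewrite inv_shift_down ?uF.
  move=> y yF; rewrite -(genK s y) inv_shift_up //.
    by rewrite gen_inv_gens negbK inA.
  by rewrite z'lb // imset_f.
have [z [zlb zs0 zmax]] := H _ s0A.
exists z; split=> // u uF; case: (lbA _ uF) => [->//|[s sA su]].
have [y [ylb ys ymax]] := H _ sA.
apply: subset_trans (ymax _ uF su) _; apply: (zmax _ ylb).
have : N (longest_par A) \subset N y.
  apply: ymax => [v vF|]; last by rewrite inversions_longest_par inE gen_refl gen_par.
  by rewrite longest_par_le; apply/forall_inP => r rA; apply: inA.
by rewrite longest_par_le => /forall_inP; apply.
Qed.

End Parabolic.

(** * Matsumoto's theorem for words in [J], simply laced case *)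

Section Matsumoto.

Variables (S : finType) (W : coxeter_system S).
Notation g := (cox_gen W).
Notation eval := (eval_word W).
Notation len := (@cox_length S W).
Notation N := (@inversions S W).
Notation par := (parabolic W).

Lemma cox_m_gt0 r s : 0 < cox_m W r s.
Proof. exact: order_gt0. Qed.

Lemma cox_mC r s : cox_m W r s = cox_m W s r.
Proof. by rewrite /cox_m -orderV invMg !genV. Qed.

Lemma cox_m_eq1 r s : (cox_m W r s == 1%N) = (r == s).
Proof.
by rewrite /cox_m order_eq1 -eq_invg_mul genV (inj_eq (@cox_gen_inj _ W)).
Qed.

Lemma cox_m_eq2 r s : cox_m W r s = 2 -> g r * g s = g s * g r.
Proof.
move=> m2; apply/eqP; rewrite -{2}(genV W s) -{2}(genV W r) -invMg eq_sym eq_invg_mul.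
by have := expg_order (g r * g s); rewrite -/(cox_m W r s) m2 expgS expg1 => ->.
Qed.

Lemma cox_m_commute r s : g r * g s = g s * g r -> cox_m W r s <= 2.
Proof.
move=> rs; apply: dvdn_leq => //; rewrite order_dvdn expgS expg1 {1}rs -!mulgA.
by rewrite genK gen_sq.
Qed.

Lemma cox_m_eq3 r s : cox_m W r s = 3 -> g r * (g s * g r) = g s * (g r * g s).
Proof.
move=> m3; have := expg_order (g r * g s); rewrite -/(cox_m W r s) m3 !expgS expg0 mulg1.
move/eqP; rewrite !mulgA -(mulgA _ (g r)) -mulgA -eq_invg_mul !invMg !genV => /eqP.
by rewrite !mulgA.
Qed.

Lemma len_gen_mul s w : len (g s * w) <= (len w).+1.
Proof.
have [a -> <-] := reduced_exists w.
by rewrite -eval_cons; apply: (len_word W (s :: a)).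
Qed.

Lemma len_gen_up s w : g s \notin N w -> len (g s * w) = (len w).+1.
Proof.
move=> sw; apply/eqP; rewrite eqn_leq len_gen_mul -{1}(genK s w) inv_mul_lt //.
by rewrite gen_inv_gens.
Qed.

Lemma len_gen_down s w : g s \in N w -> len w = (len (g s * w)).+1.
Proof.
by move=> sw; rewrite -{1}(genK s w) len_gen_up // gen_inv_gens negbK.
Qed.

Definition reduced a := size a == len (eval a).

Lemma reducedE a : reduced a = uniq (refls W a).
Proof.
apply/eqP/idP => [|ua]; first exact: reduced_uniq.
by rewrite -card_inversions card_inversions_uniq.
Qed.

Lemma reduced_cons s a : reduced (s :: a) -> reduced a /\ g s \in N (eval (s :: a)).
Proof.
rewrite !reducedE => ua; split; last by rewrite inversions_refls ?mem_head.
by move: ua => /= /andP[_]; rewrite map_inj_uniq //; apply: conjg_inj.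
Qed.

Variables (J : {set S}) (X : Type) (rho : S -> X -> X).
Hypothesis laced : simply_laced W.
Hypothesis rho_invol : forall s x, s \in J -> rho s (rho s x) = x.
Hypothesis rho_comm : forall r s x, r \in J -> s \in J -> cox_m W r s = 2 ->
  rho r (rho s x) = rho s (rho r x).
Hypothesis rho_braid : forall r s x, r \in J -> s \in J -> cox_m W r s = 3 ->
  rho r (rho s (rho r x)) = rho s (rho r (rho s x)).

(** The words are the two alternating ones of length [m(s,t)], which is 2 or 3; both spell the
    longest element of the dihedral subgroup. *)
Lemma braid_words s t : s \in J -> t \in J -> s != t -> exists p q,
  [/\ {subset s :: p <= [set s; t]}, {subset t :: q <= [set s; t]},
      eval (s :: p) = eval (t :: q), reduced (s :: p) /\ reduced (t :: q)
    & forall x, foldr rho x (s :: p) = foldr rho x (t :: q)].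
Proof.
move=> sJ tJ st.
have gst : g s != g t by rewrite (inj_eq (@cox_gen_inj _ W)).
have K2 x y : x \in [set s; t] -> y \in [set s; t] -> {subset [:: x; y] <= [set s; t]}.
  by move=> xK yK z; rewrite !inE => /orP[/eqP->|/eqP->]; [move: xK|move: yK]; rewrite !inE.
have K3 x y : x \in [set s; t] -> y \in [set s; t] -> {subset [:: x; y; x] <= [set s; t]}.
  move=> xK yK z; rewrite inE => /orP[/eqP->//|]; exact: K2.
have sK : s \in [set s; t] by rewrite !inE eqxx.
have tK : t \in [set s; t] by rewrite !inE eqxx orbT.
have m23 : cox_m W s t = 2 \/ cox_m W s t = 3.
  move: (cox_m_gt0 s t) (laced s t) (cox_m_eq1 s t); rewrite (negPf st).
  by case: cox_m => [|[|[|[|n]]]] //; [left|right].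
case: m23 => m.
  have c := cox_m_eq2 m.
  exists [:: t], [:: s]; split; try exact: K2; last by move=> x; apply: rho_comm.
    by rewrite !eval_cons !eval_nil !mulg1.
  have cj x y : g x * g y = g y * g x -> g y ^ g x = g y.
    by move=> xy; rewrite conjgE genV -xy genK.
  by rewrite !reducedE /= !inE !andbT !cj // (eq_sym (g t)) gst.
have c := cox_m_eq3 m.
exists [:: t; s], [:: s; t]; split; try exact: K3; last by move=> x; apply: rho_braid.
  by rewrite !eval_cons !eval_nil !mulg1.
have nc x y : x != y -> cox_m W x y = 3 -> reduced [:: x; y; x].
  move=> xy mxy; have e := cox_m_eq3 mxy.
  (* The reflections of this word are [g x], [g y ^ g x] and, by the braid relation, [g y]. *)
  have -> : reduced [:: x; y; x] = (g x != g y ^ g x) && (g x != g y) && (g y ^ g x != g y).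
    rewrite reducedE /= !inE !andbT negb_or (_ : (g x ^ g y) ^ g x = g y) //.
    by rewrite !conjgE !genV -e -!mulgA gen_sq mulg1 genK.
  have -> : (g x == g y ^ g x) = (g x == g y).
    by rewrite eq_sym conj_gen_eq conjgE mulKg eq_sym.
  rewrite andbb (inj_eq (@cox_gen_inj _ W)) xy conjgE genV /=.
  apply/eqP => E; suff: cox_m W x y <= 2 by rewrite mxy.
  by apply: cox_m_commute; rewrite -{1}E genK.
by split; apply: nc; rewrite // 1?eq_sym 1?cox_mC.
Qed.

Lemma reduced_in_par w : w \in par J ->
  exists a, [/\ {subset a <= J}, eval a = w & reduced a].
Proof. by case/reduced_par_word=> a [aJ aw ua]; exists a; rewrite reducedE. Qed.

Lemma Matsumoto a b : {subset a <= J} -> {subset b <= J} -> reduced a -> reduced b ->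
  eval a = eval b -> forall x, foldr rho x a = foldr rho x b.
Proof.
have [n] := ubnP (size a); elim: n => // n IHn in a b *.
case: a => [|s a] sa aJ bJ ra rb ab x.
  by move: rb; rewrite /reduced -ab -(eqP ra) => /nilP ->.
case: b => [|t b] in bJ rb ab *; first by move: ra; rewrite /reduced ab -(eqP rb).
have [ra' sN] := reduced_cons ra; have [rb' tN] := reduced_cons rb.
have sJ : s \in J by rewrite aJ ?mem_head.
have tJ : t \in J by rewrite bJ ?mem_head.
have aJ' : {subset a <= J} by move=> y ya; rewrite aJ // inE ya orbT.
have bJ' : {subset b <= J} by move=> y ya; rewrite bJ // inE ya orbT.
have sz : size b = size a.
  by apply/eqP; rewrite -eqSS -[_.+1]/(size (t :: b)) (eqP rb) -ab -(eqP ra).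
have [st|st] := eqVneq s t.
  rewrite /= st; congr rho; apply: IHn => //.
  by apply: (mulgI (g s)); rewrite -eval_cons ab eval_cons st.
have [p [q [pK qK pq [rp rq] rpq]]] := braid_words sJ tJ st.
have KJ : {subset [set s; t] <= J} by move=> y; rewrite !inE => /orP[] /eqP->.
set w := eval (s :: a) in sN ab; rewrite -ab in tN.
(* Both [g s] and [g t] are inversions of [w], so [w] has reduced words beginning with either
   alternating word. One shares its first letter with [s :: a], the other with [t :: b], and the
   induction hypothesis applies to the tails. *)
have pw : N (eval (s :: p)) \subset N w.
  apply: subset_trans (gens_below (J := [set s; t]) _).
    by rewrite subsetI inversions_reflections inversions_par ?eval_par.
  by move=> y; rewrite !inE => /orP[] /eqP->.
have [|c [cJ cE rc]] := @reduced_in_par ((eval (s :: p))^-1 * w).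
  by rewrite groupM ?groupV ?eval_par // => y /pK/KJ.
have wE : w = eval (s :: p ++ c) by rewrite -cat_cons eval_cat cE mulKVg.
have sw : (size p + size c).+1 = len w.
  by move: pw; rewrite subset_inv_len -cE -(eqP rp) -(eqP rc) => /eqP.
have pqs : size p = size q by apply/eq_add_S; rewrite -[LHS]/(size (s :: p)) (eqP rp) pq -(eqP rq).
have rpc : reduced (s :: p ++ c) by rewrite /reduced -wE -sw /= size_cat.
have wE' : w = eval (t :: q ++ c) by rewrite wE -!cat_cons !eval_cat pq.
have rqc : reduced (t :: q ++ c) by rewrite /reduced -wE' -sw /= size_cat pqs.
have catJ d e : {subset d <= J} -> {subset e <= J} -> {subset d ++ e <= J}.
  by move=> dJ eJ y; rewrite mem_cat => /orP[/dJ|/eJ].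
have pJ : {subset p <= J} by move=> y yp; apply/KJ/pK; rewrite inE yp orbT.
have qJ : {subset q <= J} by move=> y yp; apply/KJ/qK; rewrite inE yp orbT.
have -> : foldr rho x (s :: a) = foldr rho x (s :: p ++ c).
  congr rho; apply: IHn => //; [exact: catJ | by case: (reduced_cons rpc) |].
  by apply: (mulgI (g s)); rewrite -!eval_cons -wE.
have -> : foldr rho x (t :: b) = foldr rho x (t :: q ++ c).
  congr rho; apply: IHn => //; [by rewrite sz | exact: catJ | by case: (reduced_cons rqc) |].
  by apply: (mulgI (g t)); rewrite -!eval_cons -ab -wE'.
by rewrite -!cat_cons !foldr_cat rpq.
Qed.

(** Letters are added from the right end of [a]. When [s] shortens [c], Matsumoto replaces [c] by a
    reduced word starting with [s], and the two copies of [s] cancel because [rho s] is an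
    involution. *)
Lemma reduced_equiv a : {subset a <= J} -> exists c,
  [/\ {subset c <= J}, reduced c, eval c = eval a & forall x, foldr rho x c = foldr rho x a].
Proof.
have consJ s d : s \in J -> {subset d <= J} -> {subset s :: d <= J}.
  by move=> sJ dJ y; rewrite inE => /orP[/eqP->|/dJ].
elim: a => [|s a IHa] aJ.
  by exists [::]; split=> //; rewrite reducedE.
have sJ : s \in J by rewrite aJ ?mem_head.
have [|c [cJ rc ca xca]] := IHa; first by move=> y ya; rewrite aJ // inE ya orbT.
have [sc|sc] := boolP (g s \in N (eval c)); last first.
  exists (s :: c); split=> [||| x /=]; rewrite ?xca //; first exact: consJ.
    by rewrite /reduced eval_cons len_gen_up //= (eqP rc).
  by rewrite !eval_cons ca.
have [|d [dJ dE rd]] := @reduced_in_par (g s * eval c).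
  by rewrite groupM ?gen_par ?eval_par.
exists d; split=> // [|x]; first by rewrite dE eval_cons ca.
have sdE : eval (s :: d) = eval c by rewrite eval_cons dE genK.
rewrite /= -xca (@Matsumoto c (s :: d)) //; first by rewrite /= rho_invol.
  exact: consJ.
by rewrite /reduced sdE (len_gen_down sc) /= (eqP rd) dE.
Qed.

(** The relations are assumed only for letters of [J], so the presentation of [W] does not apply
    directly. This serves both for left multiplication in [W'] and for the geometric
    representation. *)
Lemma word_action a b : {subset a <= J} -> {subset b <= J} -> eval a = eval b ->
  forall x, foldr rho x a = foldr rho x b.
Proof.
move=> /reduced_equiv[a' [a'J ra <- xa]] /reduced_equiv[b' [b'J rb <- xb]] ab x.
by rewrite -xa -xb; apply: Matsumoto.
Qed.

End Matsumoto.

(** * Reading words in a second Coxeter group *)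

Section Transfer.

Variables (S : finType) (W W' : coxeter_system S) (J : {set S}).
Hypotheses (laced : simply_laced W).
Hypothesis same_m : forall r s, r \in J -> s \in J -> cox_m W r s = cox_m W' r s.

(** The letters of [J] act on [W'] by left multiplication, and a word is evaluated by acting on
    1. *)
Lemma eval_transfer a b : {subset a <= J} -> {subset b <= J} ->
  eval_word W a = eval_word W b -> eval_word W' a = eval_word W' b.
Proof.
move=> aJ bJ ab.
have E c : foldr (fun s x => cox_gen W' s * x) 1 c = eval_word W' c.
  by elim: c => [|s c /= ->]; rewrite ?eval_nil // eval_cons.
rewrite -!E; apply: (word_action laced _ _ _ aJ bJ ab).
- by move=> s x sJ; rewrite genK.
- by move=> r s x rJ sJ m; rewrite !mulgA (@cox_m_eq2 _ W' r s) // -same_m.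
move=> r s x rJ sJ m; have m' : cox_m W' r s = 3 by rewrite -same_m.
by have := congr1 (fun y => y * x) (cox_m_eq3 m'); rewrite -!mulgA.
Qed.

End Transfer.

(** * The isomorphism between [W_J] and [W'_J] *)

Section Respell.

Variables (S : finType) (W W' : coxeter_system S) (J : {set S}).
Hypotheses (laced : simply_laced W) (laced' : simply_laced W').
Hypothesis same_m : forall r s, r \in J -> s \in J -> cox_m W r s = cox_m W' r s.

(** Extends [respell] to all of [W], to work without the subgroup type; [subg] sends elements
    outside [W_J] to 1. *)
Definition transfer (w : W) : W' := respell W' (subg (parabolic W J) w).
Notation theta := transfer.

Lemma respellE (u : [subg parabolic W J]) : respell W' u = theta (sgval u).
Proof. by rewrite /theta sgvalK. Qed.

Lemma transfer_eval a : {subset a <= J} -> theta (eval_word W a) = eval_word W' a.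
Proof.
move=> aJ; rewrite /theta /respell.
have /andP[/allP bJ /eqP bE] :=
  xchooseP (parabolic_word (subgP (subg (parabolic W J) (eval_word W a)))).
apply: (eval_transfer laced same_m) => //.
by rewrite bE subgK // eval_par.
Qed.

Lemma par_eval w : w \in parabolic W J -> exists2 a, {subset a <= J} & w = eval_word W a.
Proof. by case/parabolic_word=> a /andP[/allP aJ /eqP <-]; exists a. Qed.

Lemma transfer_in w : w \in parabolic W J -> theta w \in parabolic W' J.
Proof. by case/par_eval=> a aJ ->; rewrite transfer_eval ?eval_par. Qed.

Lemma transferM v w : v \in parabolic W J -> w \in parabolic W J ->
  theta (v * w) = theta v * theta w.
Proof.
case/par_eval=> a aJ -> /par_eval[b bJ ->].
by rewrite -eval_cat !transfer_eval ?eval_cat // => y; rewrite mem_cat => /orP[/aJ|/bJ].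
Qed.

Lemma transfer1 : theta 1 = 1.
Proof. by rewrite -(eval_nil W) transfer_eval // eval_nil. Qed.

Lemma transfer_gen s : s \in J -> theta (cox_gen W s) = cox_gen W' s.
Proof.
move=> sJ; rewrite -[cox_gen W s]mulg1 -(eval_nil W) -eval_cons transfer_eval.
  by rewrite eval_cons eval_nil mulg1.
by move=> y; rewrite inE => /eqP->.
Qed.

Lemma transferJ v w : v \in parabolic W J -> w \in parabolic W J ->
  theta (v ^ w) = theta v ^ theta w.
Proof.
move=> vJ wJ; apply: (mulgI (theta w)).
rewrite -transferM ?groupJ // -conjgC transferM //; exact: conjgC.
Qed.

(** The hypotheses are symmetric in [W] and [W'], so [eval_transfer] also applies backwards. *)
Lemma transfer_inj : {in parabolic W J &, injective theta}.
Proof.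
move=> v w /par_eval[a aJ ->] /par_eval[b bJ ->]; rewrite !transfer_eval //.
move=> ab; apply: (@eval_transfer _ _ _ J laced') ab => // r s rJ sJ.
by rewrite same_m.
Qed.

Lemma transfer_surj y : y \in parabolic W' J -> exists2 x, x \in parabolic W J & theta x = y.
Proof.
case/parabolic_word=> a /andP[/allP aJ /eqP <-].
by exists (eval_word W a); rewrite ?eval_par ?transfer_eval.
Qed.

Lemma refls_transfer a : {subset a <= J} -> refls W' a = [seq theta t | t <- refls W a].
Proof.
elim: a => //= s a IHa aJ.
have sJ : s \in J by rewrite aJ ?mem_head.
have aJ' : {subset a <= J} by move=> y ya; rewrite aJ // inE ya orbT.
rewrite IHa // transfer_gen // -!map_comp; congr (_ :: _).
apply/eq_in_map => t ta /=; rewrite transferJ ?transfer_gen ?gen_par //.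
exact: refls_par ta.
Qed.

(** [theta] maps the reflections of a word to those of the same word in [W'], and injectivity on
    [W_J] preserves their multiplicities. *)
Lemma transfer_inversions t w : t \in parabolic W J -> w \in parabolic W J ->
  (theta t \in inversions (theta w)) = (t \in inversions w).
Proof.
move=> tJ /par_eval[a aJ ->]; rewrite transfer_eval // !in_inversions refls_transfer //.
rewrite count_map; congr odd; apply: eq_in_count => x xa /=.
by apply/eqP/eqP => [|->//]; apply: transfer_inj => //; apply: refls_par xa.
Qed.

Lemma transfer_le v w : v \in parabolic W J -> w \in parabolic W J ->
  (inversions (theta v) \subset inversions (theta w)) = (inversions v \subset inversions w).
Proof.
move=> vJ wJ; apply/subsetP/subsetP => le t tv.
  have tJ := subsetP (inversions_par vJ) _ tv.
  by rewrite -transfer_inversions // le // transfer_inversions.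
have /transfer_surj[x xJ xt] := subsetP (inversions_par (transfer_in vJ)) _ tv.
by rewrite -xt in tv *; rewrite transfer_inversions // le // -transfer_inversions.
Qed.

End Respell.

(** * The diagram is a forest, through the geometric representation *)

Section Forest.

Variables (S : finType) (W : coxeter_system S).
Hypothesis laced : simply_laced W.
Import Order.TTheory GRing.Theory Num.Theory.
Local Open Scope ring_scope.

Notation X := {ffun S -> int}.

Definition adj r s := cox_m W r s == 3.

Lemma adjC r s : adj r s = adj s r.
Proof. by rewrite /adj cox_mC. Qed.

Lemma adj_irr s : adj s s = false.
Proof. by rewrite /adj (eqP (_ : cox_m W s s == 1%N)) ?cox_m_eq1. Qed.

(** The Cartan matrix. It is integral in the simply laced case, so the geometric representation can
    be defined over the integers. *)
Definition cartan r s : int := if r == s then 2 else if adj r s then -1 else 0.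

Definition coroot r (x : X) : int := \sum_t cartan r t * x t.

Definition root s : X := [ffun t => (t == s)%:R].

Definition sub_scaled (k : int) (x y : X) : X := [ffun t => x t - k * y t].

Definition geom s (x : X) : X := sub_scaled (coroot s x) x (root s).

Lemma coroot_sub r k x y : coroot r (sub_scaled k x y) = coroot r x - k * coroot r y.
Proof.
rewrite /coroot mulr_sumr -sumrB; apply: eq_bigr => t _.
by rewrite ffunE mulrBr mulrCA.
Qed.

Lemma coroot_root r s : coroot r (root s) = cartan r s.
Proof.
rewrite /coroot (bigD1 s) //= ffunE eqxx mulr1 big1 ?addr0 // => t ts.
by rewrite ffunE (negPf ts) mulr0.
Qed.

Lemma geomE s x t : geom s x t = x t - coroot s x * (t == s)%:R.
Proof. by rewrite /geom !ffunE. Qed.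

Lemma coroot_geom r s x : coroot r (geom s x) = coroot r x - coroot s x * cartan r s.
Proof. by rewrite /geom coroot_sub coroot_root. Qed.

Lemma geom_invol s x : geom s (geom s x) = x.
Proof.
apply/ffunP => t; rewrite !geomE coroot_geom /cartan eqxx; ring.
Qed.

Lemma geom_comm r s x : cox_m W r s = 2%N -> geom r (geom s x) = geom s (geom r x).
Proof.
move=> m; apply/ffunP => t; rewrite !geomE !coroot_geom /cartan (eq_sym s r).
rewrite /adj (cox_mC W s) m -(cox_m_eq1 W r s) m; ring.
Qed.

Lemma geom_braid r s x : cox_m W r s = 3 ->
  geom r (geom s (geom r x)) = geom s (geom r (geom s x)).
Proof.
move=> m; apply/ffunP => t; rewrite !(geomE, coroot_geom) /cartan (eq_sym s r) !eqxx.
rewrite /adj (cox_mC W s) m -(cox_m_eq1 W r s) m /=; ring.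
Qed.

Definition act (w : W) (x : X) : X := foldr geom x (xchoose (word_exists w)).

Lemma act_eval a x : act (eval_word W a) x = foldr geom x a.
Proof.
apply: (@word_action _ W setT) => //.
- by move=> s y _; apply: geom_invol.
- by move=> r s y _ _; apply: geom_comm.
- by move=> r s y _ _; apply: geom_braid.
exact/eqP/(xchooseP (word_exists _)).
Qed.

Lemma act_geom w s x : act w (geom s x) = act (w * cox_gen W s)%g x.
Proof.
have [a ->] := evalP w.
by rewrite -eval_rcons !act_eval foldr_rcons.
Qed.

Lemma act_sub w k x y : act w (sub_scaled k x y) = sub_scaled k (act w x) (act w y).
Proof.
rewrite /act; elim: (xchoose _) => //= s a ->; apply/ffunP => t.
rewrite geomE !ffunE coroot_sub; ring.
Qed.

(* Averaging over W makes the standard form invariant. *)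
Definition form (x y : X) : int := \sum_w \sum_t act w x t * act w y t.

Lemma formC x y : form x y = form y x.
Proof. by apply: eq_bigr => w _; apply: eq_bigr => t _; rewrite mulrC. Qed.

Lemma form_sub k x y z : form (sub_scaled k x y) z = form x z - k * form y z.
Proof.
rewrite /form mulr_sumr -sumrB; apply: eq_bigr => w _.
rewrite mulr_sumr -sumrB; apply: eq_bigr => t _.
by rewrite act_sub ffunE mulrBl mulrA.
Qed.

Lemma form_geom s x y : form (geom s x) (geom s y) = form x y.
Proof.
rewrite /form (reindex_inj (mulIg (cox_gen W s))); apply: eq_bigr => w _.
apply: eq_bigr => t _; by rewrite !act_geom -mulgA gen_sq mulg1.
Qed.

(** Invariance moves [geom s] from [x] to [root s], which it negates; expanding [geom s x] on the
    other side gives the identity. *)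
Lemma form_root s x : 2 * form x (root s) = coroot s x * form (root s) (root s).
Proof.
have E : form (geom s x) (root s) = form x (geom s (root s)).
  by rewrite -(form_geom s) geom_invol.
have F : geom s (root s) = sub_scaled 2 (root s) (root s).
  by rewrite /geom coroot_root /cartan eqxx.
move: E; rewrite F formC [RHS]formC [in RHS]form_sub -formC /geom form_sub (formC (root s)).
lia.
Qed.

(** The summand of [form] at the identity is the sum of squares of the coordinates of [x]; the other
    summands are nonnegative. *)
Lemma form_ge (x : X) s : (x s) ^+ 2 <= form x x.
Proof.
have act1 : act 1%g x = x by rewrite -(eval_nil W) act_eval.
rewrite /form (bigD1 1%g) //= act1 (bigD1 s) //= -addrA ler_wpDr //.
rewrite addr_ge0 ?sumr_ge0 // => [t _|w _]; first by rewrite -expr2 sqr_ge0.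
by rewrite sumr_ge0 // => t _; rewrite -expr2 sqr_ge0.
Qed.

(* The sum v of the simple roots in l has nonpositive pairing with each of them,
   so form v v <= 0, against definiteness. *)
Lemma no_cycle (l : seq S) : uniq l -> l != [::] ->
  (forall s, s \in l -> exists r t,
     [/\ r \in l, t \in l, r != t, adj s r & adj s t]) -> False.
Proof.
move=> ul l0 deg.
pose v : X := [ffun t => (count_mem t l)%:R].
have formv x : form x v = \sum_(c <- l) form x (root c).
  rewrite /v; elim: (l) => [|c k IHk].
    rewrite big_nil formC (_ : [ffun _ => _] = sub_scaled 1 x x) ?form_sub ?mul1r ?subrr //.
    by apply/ffunP => t; rewrite !ffunE mul1r subrr.
  rewrite big_cons -IHk formC.
  rewrite (_ : [ffun _ => _] = sub_scaled (-1) [ffun t => (count_mem t k)%:R] (root c)).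
    by rewrite form_sub mulN1r opprK addrC !(formC x).
  apply/ffunP => t; rewrite !ffunE /= mulN1r opprK natrD addrC (eq_sym t).
  by congr (_ + _); case: (_ == _).
(* The diagonal entry 2 is cancelled by two neighbours of [s] in [l]; all remaining entries are at
   most 0. *)
have corv s : s \in l -> coroot s v <= 0.
  move=> sl; have [r [t [rl tl rt sr st]]] := deg s sl.
  have -> : coroot s v = \sum_(c in l) cartan s c.
    rewrite /coroot [RHS]big_mkcond; apply: eq_bigr => c _.
    by rewrite ffunE count_uniq_mem //; case: (c \in l); rewrite ?mulr1 ?mulr0.
  have sr' : r != s by apply: contraTneq sr => ->; rewrite adj_irr.
  have st' : t != s by apply: contraTneq st => ->; rewrite adj_irr.
  rewrite (bigD1 s) //= (bigD1 r) /= ?rl // (bigD1 t) /= ?tl ?st' 1?eq_sym //.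
  rewrite {1 2 3}/cartan eqxx !(eq_sym s) (negPf sr') (negPf st') sr st.
  rewrite addrA addrA -[2 + -1]/(1 : int) subrr add0r sumr_le0 // => c.
  rewrite -!andbA => /and4P[_ cs _ _]; rewrite /cartan eq_sym (negPf cs).
  by case: ifP.
have vv : 2 * form v v <= 0.
  rewrite formv mulr_sumr big_seq_cond sumr_le0 // => c; rewrite andbT => cl.
  rewrite form_root mulr_le0_ge0 ?corv //.
  by apply: le_trans (form_ge _ c); apply: sqr_ge0.
have [s sl] : exists s, s \in l.
  by case: (l) l0 => // s k _; exists s; rewrite mem_head.
have := form_ge v s; rewrite ffunE count_uniq_mem // sl expr1n; lia.
Qed.

(** Otherwise a path in [e] from [r] to [s] without repetition has at least two steps, and the edge
    between [s] and [r] closes it to a cycle, contradicting [no_cycle]. *)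
Lemma adj_connect (e : rel S) r s : subrel e adj -> adj r s ->
  connect e r s -> e r s.
Proof.
move=> ea rs /connectP[p0 /shortenP[p pe up _] sE] {p0}.
apply: contraT => nrs; exfalso; apply: (@no_cycle (r :: p)) => //.
have cyc : path.cycle adj (r :: p).
  by rewrite /= rcons_path (sub_path ea pe) -sE adjC.
have sz : (1 < size p)%N.
  case: p pe sE {up cyc} => [_ sr|x [|y p]] //=; first by rewrite sr adj_irr in rs.
  by rewrite andbT => rx sx; rewrite sx rx in nrs.
(* Once the cycle is rotated to start at [x], its second and last vertices are two distinct
   neighbours of [x]. *)
move=> x xl; have [i q Eq] := rot_to xl.
have : path.cycle adj (x :: q) by rewrite -Eq rot_cycle.
have : uniq (x :: q) by rewrite -Eq rot_uniq.
have : (2 < size (x :: q))%N by rewrite -Eq size_rot.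
have mq y : (y \in r :: p) = (y \in x :: q) by rewrite -Eq mem_rot.
case: q {Eq} mq => [|y q] // mq; case: (lastP q) mq => [//|q' z] mq _ /= /andP[_ /andP[yq _]].
rewrite rcons_path => /andP[xy /andP[_ zx]].
exists y, z; split.
- by rewrite mq !inE eqxx orbT.
- by rewrite mq !inE mem_rcons mem_head !orbT.
- by apply: contraNneq yq => ->; rewrite mem_rcons mem_head.
- by [].
by rewrite adjC; move: zx; rewrite last_rcons.
Qed.

End Forest.

(** * Atoms, meets and joins in weak order *)

Section WeakOrder.

Variables (S : finType) (W : coxeter_system S).
Notation g := (cox_gen W).
Notation len := (@cox_length S W).
Notation N := (@inversions S W).
Notation par := (parabolic W).
Notation R := (reflections W).
Notation le := (weak_order W).

Implicit Types (J K : {set S}) (w x y z u v t : W).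

Lemma weak_order_antisym x y : N x \subset N y -> N y \subset N x -> x = y.
Proof. by move=> xy yx; apply/inversions_inj/eqP; rewrite eqEsubset xy. Qed.

Lemma is_meet_unique x y z u : is_meet le x y z -> is_meet le x y u -> z = u.
Proof.
move=> [zx zy zm] [ux uy um]; apply: weak_order_antisym; rewrite -weak_orderE.
  exact: um.
exact: zm.
Qed.

Lemma is_join_unique x y z u : is_join le x y z -> is_join le x y u -> z = u.
Proof.
move=> [zx zy zm] [ux uy um]; apply: weak_order_antisym; rewrite -weak_orderE.
  exact: zm.
exact: um.
Qed.

Lemma inversions1 : N 1 = set0.
Proof. by apply/eqP; rewrite inversions_eq0. Qed.

Lemma inversions_gen s : N (g s) = [set g s].
Proof. by apply/setP => t; rewrite in_inv_gen inE. Qed.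

Lemma inversions_sub1 w : N w \subset N 1 -> w = 1.
Proof. by rewrite inversions1 subset0 inversions_eq0 => /eqP. Qed.

Lemma atoms_weak_order : atoms le = [set g s | s : S].
Proof.
apply/setP => a; rewrite inE; apply/existsP/imsetP.
  case=> b /andP[/forallP bmin /and3P[ba _ /forallP cov]].
  have b1 : b = 1 by apply: inversions_sub1; rewrite -weak_orderE.
  rewrite b1 in ba cov; have /inv_gen_exists[s sa] : a != 1 by rewrite eq_sym.
  exists s => //; have := cov (g s); rewrite !weak_orderE inversions1 sub0set inversions_gen.
  rewrite sub1set sa /= => /orP[/eqP s1|/eqP //].
  by have := in_inv_gen s (g s); rewrite s1 in_inv1 eqxx.
case=> s _ ->; exists 1; apply/andP; split.
  by apply/forallP => x; rewrite weak_orderE inversions1 sub0set.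
apply/and3P; split.
- by rewrite eq_sym -inversions_eq0 inversions_gen; apply/set0Pn; exists (g s); rewrite inE.
- by rewrite weak_orderE inversions1 sub0set.
apply/forallP => z; rewrite !weak_orderE inversions1 sub0set inversions_gen subset1 /=.
by rewrite -inversions_gen (inj_eq (@inversions_inj _ W)) inversions_eq0 orbC implybb.
Qed.

Lemma part_is_meet J w : is_meet le w (longest_par W J) (parabolic_part J w).
Proof.
split; rewrite ?weak_orderE ?inversions_part ?inversions_longest_par ?subsetIl //.
  by rewrite setSI // inversions_longest inversions_reflections.
move=> t; rewrite !weak_orderE inversions_longest_par inversions_part !subsetI => ->.
by case/andP.
Qed.

(** Exhibits longest elements as iterated joins of generators, which determines their images under a
    homomorphism. *)
Lemma longest_is_join J s : is_join le (longest_par W J) (g s) (longest_par W (s |: J)).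
Proof.
split; rewrite ?weak_orderE ?longest_par_le ?inversions_gen ?sub1set.
- apply/forall_inP => r rJ; rewrite inversions_longest_par inE gen_refl gen_par //.
  by rewrite !inE rJ orbT.
- by rewrite inversions_longest_par inE gen_refl gen_par // !inE eqxx.
move=> t; rewrite !weak_orderE !longest_par_le inversions_gen sub1set.
move=> /forall_inP Jt st; apply/forall_inP => r; rewrite !inE => /orP[/eqP->//|].
exact: Jt.
Qed.

Lemma longest_par0 : longest_par W set0 = 1.
Proof.
apply: inversions_sub1; rewrite longest_par_le; apply/forall_inP => s.
by rewrite inE.
Qed.

Lemma part_subset J u v : N u \subset N v -> N (parabolic_part J u) \subset N (parabolic_part J v).
Proof. by move=> uv; rewrite !inversions_part setSI. Qed.

Lemma part_le J t v : t \in par J -> N t \subset N v -> N t \subset N (parabolic_part J v).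
Proof. by move=> tJ tv; rewrite inversions_part subsetI tv inversions_par. Qed.

(** A reflection [t] in [W_J] has an inversion [g s] with [s] in [J]. If [t] also lay in [W_K], so
    would [g s], and [s] would be in [K]. *)
Lemma inversions_parI0 J K w t : [disjoint J & K] ->
  w \in par J -> t \in N w -> t \notin par K.
Proof.
move=> /pred0P dJK wJ tw; apply/negP => tK.
have tR := subsetP (inversions_reflections w) _ tw.
have [|s sJ st] := par_inv_gen (subsetP (inversions_par wJ) _ tw).
  by apply/eqP => t1; have := refl_inv tR; rewrite {1}t1 t1 in_inv1.
have := dJK s; rewrite /= sJ -(gen_in_par W) => /negP[].
exact: subsetP (inversions_par tK) _ st.
Qed.

(** The [J]-part of [z^-1] is trivial, since otherwise it would have a generator from [J] as an
    inversion. Thus [z] is the shortest element of its coset [z W_J]. *)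
Lemma min_coset J z y : (forall s, s \in J -> g s \notin N z^-1) ->
  y \in par J -> y \notin N z^-1.
Proof.
move=> zJ yJ; apply/negP => yz; have := parabolic_part_in J z^-1.
move=> /par_inv_gen[|s sJ]; last by rewrite inversions_part inE (negPf (zJ s sJ)).
by rewrite -inversions_eq0; apply/set0Pn; exists y; rewrite inversions_part inE yz.
Qed.

(** For such [z], the set [N (z * v)] is the disjoint union of [N z] and a conjugate of [N v]. *)
Lemma coset_le J z u v : (forall s, s \in J -> g s \notin N z^-1) ->
  v \in par J -> N u \subset N v -> N (z * u) \subset N (z * v).
Proof.
move=> zJ vJ /subsetP uv; apply/subsetP => x; rewrite !in_invM.
have dis : x ^ z \in N v -> x \notin N z.
  move=> xv; have := min_coset zJ (subsetP (inversions_par vJ) _ xv).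
  by rewrite in_invV conjgK.
have := uv (x ^ z).
move: dis; do 3!case: (_ \in _) => //=.
all: by do ?[move/(_ isT) => // | move=> _].
Qed.

(** For an upper bound [t], both generators are inversions of [z^-1 * t], so [longest_par_le] puts
    the longest element of the pair below it. *)
Lemma coset_is_join r s z :
  g r \notin N z^-1 -> g s \notin N z^-1 ->
  is_join le (z * g r) (z * g s) (z * longest_par W [set r; s]).
Proof.
move=> rz sz; set K := [set r; s].
have zK q : q \in K -> g q \notin N z^-1 by rewrite !inE => /orP[] /eqP->.
have le_zw q : q \in K -> N (z * g q) \subset N (z * longest_par W K).
  move=> qK; apply: (@coset_le K) => //; first exact: longest_par_in.
  by rewrite inversions_gen sub1set inversions_longest_par inE gen_refl gen_par.
split; try by rewrite weak_orderE le_zw // !inE eqxx ?orbT.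
move=> t; rewrite !weak_orderE => rt st.
have zrt : N z \subset N t.
  apply: subset_trans rt; rewrite -{1}[z]mulg1; apply: (@coset_le K) => //.
    by rewrite gen_par // !inE eqxx.
  by rewrite inversions1 sub0set.
have qt q : q \in K -> g q \in N (z^-1 * t).
  move=> qK; rewrite in_invM (negPf (zK q qK)) /=.
  have /subsetP : N (z * g q) \subset N t by move: qK; rewrite !inE => /orP[] /eqP->.
  by apply; rewrite in_invM conjgKV in_inv_gen eqxx -in_invV (negPf (zK q qK)).
have /subsetP wt : N (longest_par W K) \subset N (z^-1 * t).
  by rewrite longest_par_le; apply/forall_inP => q; apply: qt.
apply/subsetP => x; rewrite in_invM.
case: (boolP (x \in N z)) => [/(subsetP zrt) //|xz /= /wt].
by rewrite in_inv_mulV conjgK (negPf xz).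
Qed.

Lemma gen_conj_neq r s : cox_m W r s = 3 -> g r ^ g s != g r.
Proof.
move=> m; rewrite conjgE genV; apply/eqP => E; suff: cox_m W r s <= 2 by rewrite m.
by apply: cox_m_commute; rewrite -{2}E genK.
Qed.

Lemma in_inv_gen2 r s t : (t \in N (g r * g s)) = (t == g r) (+) (t == g s ^ g r).
Proof. by rewrite in_invM !in_inv_gen conj_gen_eq. Qed.

Lemma longest_pair2 r s : r != s -> cox_m W r s = 2 -> longest_par W [set r; s] = g r * g s.
Proof.
move=> rs m; apply: weak_order_antisym; last first.
  rewrite inversions_longest_par subsetI inversions_reflections inversions_par //.
  by rewrite groupM ?gen_par // !inE eqxx ?orbT.
rewrite longest_par_le; apply/forall_inP => q; rewrite !inE => /orP[] /eqP->.
  by rewrite gen_inv_gens in_inv_gen (inj_eq (@cox_gen_inj _ W)).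
by rewrite (cox_m_eq2 m) gen_inv_gens in_inv_gen (inj_eq (@cox_gen_inj _ W)) eq_sym.
Qed.

Lemma longest_pair3 r s : r != s -> cox_m W r s = 3 ->
  longest_par W [set r; s] = g r * (g s * g r).
Proof.
move=> rs m; have ms : cox_m W s r = 3 by rewrite cox_mC.
apply: weak_order_antisym; last first.
  rewrite inversions_longest_par subsetI inversions_reflections inversions_par //.
  by rewrite !groupM ?gen_par // !inE eqxx ?orbT.
rewrite longest_par_le; apply/forall_inP => q; rewrite !inE => /orP[] /eqP->.
  rewrite gen_inv_gens in_inv_gen2 (inj_eq (@cox_gen_inj _ W)) (negPf rs) eq_sym.
  by rewrite (negPf (gen_conj_neq m)).
rewrite (cox_m_eq3 m) gen_inv_gens in_inv_gen2 (inj_eq (@cox_gen_inj _ W)) eq_sym (negPf rs).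
by rewrite eq_sym (negPf (gen_conj_neq ms)).
Qed.

Lemma lenV w : len w^-1 = len w.
Proof.
rewrite -!card_inversions; have -> : N w^-1 = N w :^ w.
  by apply/setP => t; rewrite in_invV mem_conjg.
exact: cardJg.
Qed.

Lemma len_mul_gen_down s w : g s \in N w^-1 -> len w = (len (w * g s)).+1.
Proof. by move=> sw; rewrite -lenV (len_gen_down sw) -[in RHS]lenV invMg genV. Qed.

Lemma len_mul_gen s w : len (w * g s) <= (len w).+1.
Proof. by rewrite -lenV invMg genV -(lenV w) len_gen_mul. Qed.

Lemma inv_mulV_le x y z : N x \subset N y -> N y \subset N z ->
  N (x^-1 * y) \subset N (x^-1 * z).
Proof.
move=> xy yz; rewrite !inv_mulV ?(subset_trans xy) // conjSg; exact: setSD.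
Qed.

Lemma in_diagram r s : simply_laced W -> ([set r; s] \in diagram W) = adj W r s.
Proof.
move=> laced; rewrite /adj eqn_leq laced inE /=; apply/existsP/idP.
  case=> a /existsP[b /and3P[/eqP/setP E ab m]].
  move: (E r) (E s) (E a) (E b); rewrite !inE !eqxx !orbT /=.
  case/esym/orP=> /eqP->; case/esym/orP=> /eqP->; rewrite ?orbb ?(negPf ab) //.
    by move=> _; rewrite eq_sym (negPf ab).
  by rewrite cox_mC.
move=> m; exists r; apply/existsP; exists s; rewrite eqxx m andbT /=.
by apply: contraTneq m => ->; rewrite (eqP (_ : cox_m W s s == 1%N)) // cox_m_eq1.
Qed.

End WeakOrder.

(** * The edge-erasing map is compressive *)

Section EdgeErasing.

Variables (S : finType) (W W' : coxeter_system S) (E : {set {set S}}).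
Hypotheses (laced : simply_laced W) (laced' : simply_laced W').
Hypotheses (diagE : diagram W' = diagram W :\: E).

Notation N := (@inversions S W).
Notation N' := (@inversions S W').
Notation comp := (component W E).
Notation eta := (@edge_erasing S W W' E).

Implicit Types (J K : comp).

Let e := [rel a b | [set a; b] \in diagram W :\: E].

Lemma erased_adj a b : e a b = adj W' a b.
Proof. by rewrite /= -diagE in_diagram. Qed.

Lemma erased_sub : subrel e (adj W).
Proof. by move=> a b; rewrite /= inE in_diagram // => /andP[]. Qed.

Lemma erased_sym : connect_sym e.
Proof. by apply: sym_connect_sym => a b; rewrite /= setUC. Qed.

Lemma comp_connect J r s : r \in val J -> (s \in val J) = connect e r s.
Proof.
case: J => J /= /imsetP[x _ ->]; rewrite !inE => xr.
exact: (same_connect erased_sym xr).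
Qed.

Lemma comp_exists s : exists J, s \in val J.
Proof.
have sJ : [set t | connect e s t] \in erased_components W E by apply: imset_f.
by exists (exist (fun A => A \in erased_components W E) _ sJ); rewrite inE connect0.
Qed.

Lemma comp_disjoint J K : J != K -> [disjoint val J & val K].
Proof.
move=> JK; apply/pred0P => s /=; apply: contraNF JK => /andP[sJ sK].
by apply/eqP/val_inj/setP => t; rewrite (comp_connect _ sJ) (comp_connect _ sK).
Qed.

(** By [adj_connect] an edge of [W] between two vertices of one component is not erased. Adjacency
    therefore agrees, and it determines [m] in simply laced systems. *)
Lemma comp_same_m J r s : r \in val J -> s \in val J -> cox_m W r s = cox_m W' r s.
Proof.
move=> rJ sJ; have [<-|rs] := eqVneq r s.
  by apply/eqP; rewrite (eqP (_ : cox_m W' r r == 1%N)) cox_m_eq1.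
have: (adj W r s) = (adj W' r s).
  rewrite -erased_adj; apply/idP/idP => [rs3|]; last exact: erased_sub.
  by apply: (adj_connect laced erased_sub) => //; rewrite -(comp_connect _ rJ).
have := cox_m_eq1 W r s; have := cox_m_eq1 W' r s; rewrite (negPf rs) /adj.
move: (cox_m_gt0 W r s) (cox_m_gt0 W' r s) (laced r s) (laced' r s).
by case: (cox_m W r s) => [|[|[|[|]]]] //; case: (cox_m W' r s) => [|[|[|[|]]]].
Qed.

Lemma comp_commute J K r s : J != K -> r \in val J -> s \in val K ->
  commute (cox_gen W' r) (cox_gen W' s).
Proof.
move=> JK rJ sK; have sJ : s \notin val J.
  apply/negP => sJ; have /pred0P/(_ s) := comp_disjoint JK.
  by rewrite /= sJ sK.
have rs : r != s by apply: contraNneq sJ => <-.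
apply: cox_m_eq2; have : ~~ adj W' r s.
  rewrite -erased_adj; apply: contra sJ => rs'.
  by rewrite (comp_connect _ rJ) connect1.
have := cox_m_eq1 W' r s; rewrite (negPf rs) /adj.
by move: (cox_m_gt0 W' r s) (laced' r s); case: cox_m => [|[|[|[|]]]].
Qed.

Lemma comp_par_commute J K x y : J != K ->
  x \in parabolic W' (val J) -> y \in parabolic W' (val K) -> commute x y.
Proof.
move=> JK xJ yK; apply: (centP _ _ yK).
suff: parabolic W' (val J) \subset 'C(parabolic W' (val K)) by move/subsetP; apply.
rewrite /= cent_gen gen_subG; apply/subsetP => _ /imsetP[r rJ ->].
by apply/centP => _ /imsetP[s sK ->]; apply: comp_commute JK rJ sK.
Qed.

(** Conjugation by a generator of the same component stays in [W'_J]; a generator of another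
    component centralizes [W'_J]. *)
Lemma comp_reflections t : t \in reflections W' -> exists J, t \in parabolic W' (val J).
Proof.
case/reflP=> s [x ->]; have [a ->] := evalP x; have [J sJ] := comp_exists s.
exists J; elim/last_ind: a => [|a r IHa]; first by rewrite eval_nil conjg1 gen_par.
rewrite eval_rcons conjgM; have [K rK] := comp_exists r.
have [JK|JK] := eqVneq J K; first by rewrite groupJ // gen_par // JK.
by rewrite conjgE (comp_par_commute JK IHa (gen_par W' rK)) mulKg.
Qed.

(** Factors from components other than [K] commute with [t] and do not have it as an inversion. *)
Lemma comp_prod_inversions (y : comp -> W') (l : seq comp) K t :
  (forall J, y J \in parabolic W' (val J)) -> uniq l -> t \in parabolic W' (val K) ->
  (t \in N' (\prod_(J <- l) y J)) = (K \in l) && (t \in N' (y K)).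
Proof.
move=> yJ ul tK; elim: l t ul tK => [|J l IHl] t; first by rewrite big_nil in_inv1.
case/andP=> Jl ul tK; rewrite big_cons in_invM inE; have [KJ|KJ] := eqVneq K J.
  by rewrite -KJ in Jl *; rewrite IHl ?groupJ // (negPf Jl) addbF.
have tJ : t \notin N' (y J).
  by apply: contraL tK; apply: inversions_parI0 (yJ J); rewrite comp_disjoint // eq_sym.
by rewrite (negPf tJ) conjgE (comp_par_commute KJ tK (yJ J)) mulKg IHl.
Qed.

Definition comp_transfer J := @transfer S W W' (val J).
Notation theta := comp_transfer.

Lemma theta_in J w : w \in parabolic W (val J) -> theta J w \in parabolic W' (val J).
Proof. exact: (transfer_in laced (@comp_same_m J)). Qed.

Lemma theta_surj J y : y \in parabolic W' (val J) ->
  exists2 x, x \in parabolic W (val J) & theta J x = y.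
Proof. exact: (transfer_surj laced (@comp_same_m J)). Qed.

Lemma theta_le J v w : v \in parabolic W (val J) -> w \in parabolic W (val J) ->
  (N' (theta J v) \subset N' (theta J w)) = (N v \subset N w).
Proof. exact: (transfer_le laced laced' (@comp_same_m J)). Qed.

(** By [comp_prod_inversions] only the factor at [J] has inversions in [W'_J]. This reduces claims
    about [eta] to single components. *)
Lemma erasing_part J w :
  parabolic_part (val J) (eta w) = theta J (parabolic_part (val J) w).
Proof.
have yJ K : theta K (parabolic_part (val K) w) \in parabolic W' (val K).
  by rewrite theta_in ?parabolic_part_in.
apply: inversions_inj; apply/setP => t; rewrite inversions_part inE.
have [tJ|tJ] := boolP (t \in parabolic W' (val J)); last first.
  rewrite andbF; apply/esym/negbTE; apply: contra tJ.
  exact: (subsetP (inversions_par (yJ J))).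
have -> : eta w = \prod_(K : comp) theta K (parabolic_part (val K) w).
  by apply: eq_bigr => K _; rewrite respellE ffunE.
by rewrite andbT (comp_prod_inversions (K := J) yJ) ?index_enum_uniq // mem_index_enum.
Qed.

Lemma comp_part_le (x y : W') :
  (forall J, N' (parabolic_part (val J) x) \subset N' (parabolic_part (val J) y)) ->
  N' x \subset N' y.
Proof.
move=> xy; apply/subsetP => t tx.
have [J tJ] := comp_reflections (subsetP (inversions_reflections x) _ tx).
by have := subsetP (xy J) t; rewrite !inversions_part !inE tx tJ => /(_ isT)/andP[].
Qed.

Lemma comp_part_eq (x y : W') :
  (forall J, parabolic_part (val J) x = parabolic_part (val J) y) -> x = y.
Proof. by move=> xy; apply: weak_order_antisym; apply: comp_part_le => J; rewrite xy. Qed.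

Lemma erasing_mono u v : N u \subset N v -> N' (eta u) \subset N' (eta v).
Proof.
move=> uv; apply: comp_part_le => J.
by rewrite !erasing_part theta_le ?parabolic_part_in // part_subset.
Qed.

Lemma erasing_meet x y z : is_meet (weak_order W) x y z ->
  is_meet (weak_order W') (eta x) (eta y) (eta z).
Proof.
case=> zx zy zmax; rewrite !weak_orderE in zx zy.
split; rewrite ?weak_orderE ?erasing_mono // => t; rewrite !weak_orderE => tx ty.
apply: comp_part_le => J.
have [t0 t0J t0E] := theta_surj (parabolic_part_in (val J) t).
(* [t0] corresponds to the [J]-part of [t]; if [t] is below [eta v], then [t0] is below [v_J] and
   hence below [v]. *)
have below v : N' t \subset N' (eta v) -> weak_order W t0 v.
  move/(part_subset (val J)); rewrite erasing_part -t0E theta_le ?parabolic_part_in //.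
  by rewrite inversions_part weak_orderE subsetI => /andP[].
rewrite erasing_part -t0E theta_le ?parabolic_part_in // part_le //.
by rewrite -weak_orderE; apply: zmax; apply: below.
Qed.

Lemma erasing_join x y z : is_join (weak_order W) x y z ->
  is_join (weak_order W') (eta x) (eta y) (eta z).
Proof.
case=> xz yz zmin; rewrite !weak_orderE in xz yz.
split; rewrite ?weak_orderE ?erasing_mono // => t; rewrite !weak_orderE => tx ty.
apply: comp_part_le => J.
have [t0 t0J t0E] := theta_surj (parabolic_part_in (val J) t).
(* An element is below [u] exactly when its [J]-part is below [t0], which turns a bound on one
   component into a bound in [W]. *)
have [u uE] := par_bound t0J.
have above v : N' (eta v) \subset N' t -> weak_order W v u.
  move/(part_subset (val J)); rewrite erasing_part -t0E theta_le ?parabolic_part_in //.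
  rewrite weak_orderE uE inversions_part => /subsetP vt; apply/subsetP => r rv.
  rewrite in_setU in_setD (subsetP (inversions_reflections v)) // andbT -implyNb negbK.
  by apply/implyP => rJ; apply: vt; rewrite inE rv.
have := zmin u (above _ tx) (above _ ty); rewrite weak_orderE uE => /subsetP zu.
rewrite erasing_part -t0E theta_le ?parabolic_part_in //.
apply/subsetP => r; rewrite inversions_part inE => /andP[/zu].
by rewrite in_setU in_setD => /orP[/andP[/negPf->]|].
Qed.

(** A preimage is the meet of the elements given by [par_bound] for the preimages [x] of the
    [J]-parts of [y]. Each [x] is below all of them, as its inversions lie outside [W_K] for every
    other component [K]. *)
Lemma erasing_surj (y : W') : exists w, eta w = y.
Proof.
pose ok (u : W) J x := [&& x \in parabolic W (val J),
  theta J x == parabolic_part (val J) y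
  & N u == (reflections W :\: parabolic W (val J)) :|: N x].
(* The top element does not change the meet; it guarantees that [F] has a member. *)
pose F := longest W |: [set u | [exists J, exists x, ok u J x]].
have [|z [zF zmax]] := @glb_exists _ _ F (longest W); first by rewrite !inE eqxx.
exists z; apply: comp_part_eq => J; rewrite erasing_part.
have [x xJ xE] := theta_surj (parabolic_part_in (val J) y).
rewrite -xE; congr (theta J _); apply: weak_order_antisym.
  have [u uE] := par_bound xJ.
  have uF : u \in F.
    rewrite !inE; apply/orP; right; apply/existsP; exists J; apply/existsP; exists x.
    by rewrite /ok xJ xE uE !eqxx.
  apply/subsetP => t; rewrite inversions_part inE => /andP[/(subsetP (zF _ uF))].
  by rewrite uE in_setU in_setD => /orP[/andP[/negPf->]|].
apply: part_le => //; apply: zmax => u; rewrite !inE => /orP[/eqP->|].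
  by rewrite inversions_longest inversions_reflections.
case/existsP=> K /existsP[x' /and3P[x'K /eqP x'E /eqP ->]].
have [JK|JK] := eqVneq J K.
  subst K; rewrite (_ : x' = x) ?subsetUr //.
  apply: (transfer_inj laced laced' (@comp_same_m J)) => //.
  by rewrite -[LHS]/(theta J x') x'E -xE.
apply/subsetP => t tx; rewrite in_setU in_setD (subsetP (inversions_reflections x)) //.
by rewrite (inversions_parI0 (comp_disjoint JK) xJ).
Qed.

Lemma erasing_gen s : eta (cox_gen W s) = cox_gen W' s.
Proof.
apply: comp_part_eq => J; rewrite erasing_part.
have [sJ|sJ] := boolP (s \in val J).
  by rewrite !part_id ?gen_par //; apply: (transfer_gen laced (@comp_same_m J)).
have part1 (V : coxeter_system S) : parabolic_part (val J) (cox_gen V s) = 1.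
  apply: inversions_sub1; rewrite inversions_part inversions_gen inversions1.
  apply/subsetP => t; rewrite !inE => /andP[/eqP -> sJ'].
  by rewrite gen_in_par (negPf sJ) in sJ'.
by rewrite !part1; apply: (transfer1 laced (@comp_same_m J)).
Qed.

Lemma erasing_compressive : compressive (weak_order W) (weak_order W') eta.
Proof.
split.
- by split=> x y z; [apply: erasing_meet | apply: erasing_join].
- exact: erasing_surj.
- rewrite atoms_weak_order => _ _ /imsetP[r _ ->] /imsetP[s _ ->].
  by rewrite !erasing_gen => /cox_gen_inj ->.
rewrite !atoms_weak_order -imset_comp; apply: eq_imset => s /=.
exact: erasing_gen.
Qed.

End EdgeErasing.

(** * A homomorphism fixing the generators is determined on [W_J] *)

Section Uniqueness.

Variables (S : finType) (W W' : coxeter_system S) (J : {set S}).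
Hypotheses (laced : simply_laced W) (laced' : simply_laced W').
Hypothesis same_m : forall r s, r \in J -> s \in J -> cox_m W r s = cox_m W' r s.

Notation g := (cox_gen W).
Notation g' := (cox_gen W').
Notation len := (@cox_length S W).
Notation N := (@inversions S W).
Notation N' := (@inversions S W').
Notation par := (parabolic W).
Notation par' := (parabolic W').
Notation theta := (@transfer S W W' J).
Notation le := (weak_order W).
Notation le' := (weak_order W').

Implicit Types x y z u v w : W.

Variable f : W -> W'.
Hypothesis f_hom : lattice_hom le le' f.
Hypothesis f_surj : forall y : W', exists w, f w = y.
Hypothesis f_gen : forall s, f (g s) = g' s.

Let thetaM := transferM laced same_m.
Let theta_gen := transfer_gen laced same_m.
Let theta1 := transfer1 laced same_m.
Let theta_in := transfer_in laced same_m.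
Let theta_le := transfer_le laced laced' same_m.

Lemma hom_mono u v : N u \subset N v -> N' (f u) \subset N' (f v).
Proof.
move=> uv; rewrite -weak_orderE.
have [] // : is_meet le' (f u) (f v) (f u).
by apply: (proj1 f_hom); split; rewrite ?weak_orderE.
Qed.

Lemma hom1 : f 1 = 1.
Proof.
have [w w1] := f_surj 1; apply: inversions_sub1; rewrite -w1.
by apply: hom_mono; rewrite inversions1 sub0set.
Qed.

Lemma hom_longest K : f (longest_par W K) = longest_par W' K.
Proof.
have -> : K = [set:: enum K] by apply/setP => s; rewrite inE mem_enum.
elim: (enum K) => [|s k IHk].
  by rewrite set_nil !longest_par0 hom1.
rewrite set_cons; apply: is_join_unique (longest_is_join W' _ s).
by rewrite -IHk -f_gen; apply: (proj2 f_hom); apply: longest_is_join.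
Qed.

Lemma hom_part K w : f (parabolic_part K w) = parabolic_part K (f w).
Proof.
apply: is_meet_unique (part_is_meet K (f w)); rewrite -hom_longest.
by apply: (proj1 f_hom); apply: part_is_meet.
Qed.

(** [f] maps [W_J] onto [W'_J], as [hom_part] shows on the [J]-part of any preimage; the two sets
    are equinumerous through [theta]. *)
Lemma hom_par_inj : {in par J &, injective f}.
Proof.
have fE : f @: par J = par' J.
  apply/setP => y; apply/imsetP/idP => [[x xJ ->]|yJ].
    by rewrite -(part_id xJ) hom_part parabolic_part_in.
  have [w wy] := f_surj y; exists (parabolic_part J w); first exact: parabolic_part_in.
  by rewrite hom_part wy part_id.
apply/imset_injP; rewrite fE.
have -> : pred_of_set (par' J) = pred_of_set (theta @: par J).
  congr pred_of_set; apply/setP => y; apply/idP/imsetP => [yJ|[x xJ ->]]; last exact: theta_in.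
  by have [x xJ <-] := transfer_surj laced same_m yJ; exists x.
by rewrite card_in_imset //; apply: (transfer_inj laced laced' same_m).
Qed.

(** The join is taken in all of [W'], so an upper bound [t] is replaced by its [J]-part, which lies
    above the same elements of [W'_J]. *)
Lemma transfer_join x y z : x \in par J -> y \in par J -> z \in par J ->
  is_join le x y z -> is_join le' (theta x) (theta y) (theta z).
Proof.
move=> xJ yJ zJ [xz yz zmin]; rewrite !weak_orderE in xz yz.
split; rewrite ?weak_orderE ?theta_le // => t; rewrite !weak_orderE => tx ty.
have [t0 t0J t0E] := transfer_surj laced same_m (parabolic_part_in J t).
have le0 v : v \in par J -> (N' (theta v) \subset N' t) = (N v \subset N t0).
  move=> vJ; rewrite -theta_le // t0E inversions_part subsetI.
  by rewrite (inversions_par (theta_in vJ)) andbT.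
rewrite le0 // in tx; rewrite le0 // in ty; rewrite le0 //.
by rewrite -weak_orderE; apply: zmin; rewrite weak_orderE.
Qed.

Lemma hom_dihedral r s (z : W) : r \in J -> s \in J -> r != s -> z \in par J ->
  g r \notin N z^-1 -> g s \notin N z^-1 ->
  f (z * g r) = theta (z * g r) -> f (z * g s) = theta (z * g s) ->
  let w0 := longest_par W [set r; s] in
  f (z * w0) = theta (z * w0) /\ f (z * (g r * g s)) = theta (z * (g r * g s)).
Proof.
move=> rJ sJ rs zJ rz sz fr fs w0.
have KJ : par [set r; s] \subset par J.
  rewrite gen_subG; apply/subsetP => _ /imsetP[q qK ->]; rewrite !inE in qK.
  by apply: gen_par; case/orP: qK => /eqP->.
have w0J : w0 \in par J := subsetP KJ _ (longest_par_in _ _).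
have zw0 : f (z * w0) = theta (z * w0).
  have j := coset_is_join rz sz.
  apply: is_join_unique (proj2 f_hom _ _ _ j) _; rewrite fr fs.
  by apply: transfer_join => //; rewrite groupM ?gen_par.
split=> //; have m23 : cox_m W r s = 2 \/ cox_m W r s = 3.
  move: (cox_m_gt0 W r s) (laced r s) (cox_m_eq1 W r s); rewrite (negPf rs).
  by case: cox_m => [|[|[|[|]]]] //; [left|right].
case: m23 => m; first by rewrite -(longest_pair2 rs m) -/w0 zw0.
have w0E : w0 = g r * (g s * g r) by apply: longest_pair3.
have rK : g r \in par [set r; s] by rewrite gen_par // !inE eqxx.
have sK : g s \in par [set r; s] by rewrite gen_par // !inE eqxx orbT.
have zK q : q \in [set r; s] -> g q \notin N z^-1 by rewrite !inE => /orP[] /eqP->.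
set x := z * (g r * g s).
have xJ : x \in par J by rewrite !groupM ?gen_par.
have r_x : N (z * g r) \subset N x.
  apply: (coset_le zK); first by rewrite groupM.
  rewrite inversions_gen sub1set gen_inv_gens in_inv_gen (inj_eq (@cox_gen_inj _ W)) //.
have x_w0 : N x \subset N (z * w0).
  apply: (coset_le zK); first exact: longest_par_in.
  rewrite inversions_longest_par subsetI inversions_reflections inversions_par //.
  by rewrite groupM.
have m' : cox_m W' r s = 3 by rewrite -same_m.
have fr' : f (z * g r) = theta z * g' r by rewrite fr thetaM ?gen_par // theta_gen.
have fw0' : f (z * w0) = theta z * (g' r * (g' s * g' r)).
  by rewrite zw0 w0E !thetaM ?groupM ?gen_par // !theta_gen.
(* [y] measures [f x] from [f (z * g r)]. Monotonicity puts it below [g' s * g' r], and injectivity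
   of [f] on [W_J] excludes both ends. *)
set y := (theta z * g' r)^-1 * f x.
have y_le : N' y \subset N' (g' s * g' r).
  have -> : g' s * g' r = (theta z * g' r)^-1 * f (z * w0).
    by rewrite fw0' (mulgA (theta z)) mulKg.
  by rewrite /y -fr' inv_mulV_le // hom_mono.
have y1 : y != 1.
  rewrite -eq_mulVg1 -fr'; apply/eqP => /(hom_par_inj (groupM zJ (gen_par W rJ)) xJ)/mulgI/eqP.
  by rewrite -{1}[g r]mulg1 (inj_eq (mulgI _)) eq_sym -inversions_eq0 inversions_gen
     => /eqP/setP/(_ (g s)); rewrite !inE eqxx.
have ysr : y != g' s * g' r.
  apply/eqP => yE.
  have : f x = f (z * w0) by rewrite -[f x](mulKVg (theta z * g' r)) -/y yE fw0' !mulgA.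
  move/(hom_par_inj xJ (groupM zJ w0J))/mulgI/eqP.
  rewrite w0E (inj_eq (mulgI _)) -{1}[g s]mulg1 (inj_eq (mulgI _)) eq_sym -inversions_eq0.
  by rewrite inversions_gen => /eqP/setP/(_ (g r)); rewrite !inE eqxx.
have in_y t : t \in N' y -> t = g' s \/ t = g' r ^ g' s.
  move/(subsetP y_le); rewrite in_inv_gen2.
  by case: eqP => [->|_]; [left | case: eqP => [->|//]; right].
(* Some generator is an inversion of [y]. If it were [g' r ^ g' s], it would lie in the dihedral
   subgroup and be [g' r] or [g' s]; the former contradicts [m = 3]. *)
have sy : g' s \in N' y.
  have [q qy] := inv_gen_exists y1; case: (in_y _ qy) => qE; first by rewrite -qE.
  have : g' q \in parabolic W' [set r; s].
    by rewrite qE groupJ ?gen_par // !inE eqxx ?orbT.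
  rewrite gen_in_par !inE => /orP[]/eqP qrs; last by rewrite -qrs.
  by have := gen_conj_neq m'; rewrite -qE qrs eqxx.
have ys : y = g' s.
  (* A second inversion of [y] would make it equal to [g' s * g' r]. *)
  apply: weak_order_antisym; last by rewrite inversions_gen sub1set.
  apply/subsetP => t ty; rewrite in_inv_gen; case: (in_y _ ty) => [->//|tE].
  case/eqP: ysr; apply: weak_order_antisym => //; apply/subsetP => q.
  rewrite in_inv_gen2; case: (q =P g' s) => [->//|_ /= /eqP ->]; by rewrite -tE.
rewrite -[f x](mulKVg (theta z * g' r)) -/y ys /x !thetaM ?groupM ?gen_par //.
by rewrite !theta_gen // mulgA.
Qed.

(** A reduced word ends in two letters [r], [s], so [x = z r s] with [z r] longer than [z]. If [z s]
    is longer too, [hom_dihedral] applies at [z]; otherwise it applies at the shorter [u = z s],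
    where [x] is the join of [u r] and [u s]. *)
Lemma hom_transfer (x : W) : x \in par J -> f x = theta x.
Proof.
have [n] := ubnP (len x); elim: n x => // n IHn x xn xJ.
have [a [aJ aE ra]] := reduced_in_par xJ.
case: (lastP a) aJ aE ra => [_ <- _|b s]; first by rewrite eval_nil hom1 theta1.
case: (lastP b) => [sJ <- _|{}b r].
  have {}sJ : s \in J by apply: sJ; rewrite inE.
  by rewrite eval_rcons eval_nil mul1g f_gen theta_gen.
set z := eval_word W b => aJ aE ra.
have sJ : s \in J by apply: aJ; rewrite mem_rcons mem_head.
have rJ : r \in J by apply: aJ; rewrite !(mem_rcons, inE) eqxx orbT.
have zJ : z \in par J.
  by apply: eval_par => q qb; apply: aJ; rewrite !(mem_rcons, inE) qb !orbT.
have xE : x = z * g r * g s by rewrite -aE !eval_rcons.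
have lenx : len x = (size b).+2 by rewrite -aE -(eqP ra) !size_rcons.
have lz : len z <= size b := len_word W b.
have lzr := len_mul_gen r z; have lzrs := len_mul_gen s (z * g r).
rewrite -xE lenx in lzrs.
have rz : g r \notin N z^-1.
  by apply/negP => /len_mul_gen_down; lia.
have rs : r != s.
  by apply/negP => /eqP rs; move: lenx; rewrite xE rs -mulgA gen_sq mulg1; lia.
have [sz|sz] := boolP (g s \in N z^-1); last first.
  have lzs := len_mul_gen s z.
  have [||_] := hom_dihedral rJ sJ rs zJ rz sz; last by rewrite mulgA -xE.
    by apply: IHn; [lia | rewrite groupM ?gen_par].
  by apply: IHn; [lia | rewrite groupM ?gen_par].
set u := z * g s.
have uz : z = u * g s by rewrite -mulgA gen_sq mulg1.
have lu : len z = (len u).+1 by apply: len_mul_gen_down.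
have su : g s \notin N u^-1 by rewrite invMg genV gen_inv_gens negbK.
have uJ : u \in par J by rewrite groupM ?gen_par.
(* If [r] and [s] commuted, [x] would equal [u * g r], which is too short. *)
have m : cox_m W r s = 3.
  move: (cox_m_gt0 W r s) (laced r s) (cox_m_eq1 W r s) (@cox_m_eq2 _ W r s).
  rewrite (negPf rs); case: cox_m => [|[|[|[|]]]] // _ _ _ /(_ erefl) c.
  have xu : x = u * g r by rewrite xE uz -!mulgA c genK.
  by have := len_mul_gen r u; rewrite -xu; lia.
have xE' : x = u * longest_par W [set r; s].
  by rewrite (longest_pair3 rs m) (cox_m_eq3 m) xE uz !mulgA.
have ru : g r \notin N u^-1.
  apply/negP => /len_mul_gen_down lur.
  have xu : x = u * g r * g s * g r by rewrite xE' (longest_pair3 rs m) !mulgA.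
  have := len_mul_gen s (u * g r); have := len_mul_gen r (u * g r * g s).
  by rewrite -xu; lia.
have lus := len_mul_gen s u; have lur := len_mul_gen r u.
have [||] := hom_dihedral rJ sJ rs uJ ru su; last by rewrite -xE'.
  by apply: IHn; [lia | rewrite groupM ?gen_par].
by apply: IHn; [lia | rewrite groupM ?gen_par].
Qed.

End Uniqueness.

Theorem corollary3p3 (S : finType) (W W' : coxeter_system S)
    (E : {set {set S}})
    (W_laced : simply_laced W) (W'_laced : simply_laced W')
    (E_edges : E \subset diagram W)
    (W'_diagram : diagram W' = diagram W :\: E) :
  [/\ compressive (weak_order W) (weak_order W') (edge_erasing W' E),
      forall s : S, edge_erasing W' E (cox_gen W s) = cox_gen W' s
    & forall f : W -> W',
        compressive (weak_order W) (weak_order W') f ->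
        (forall s : S, f (cox_gen W s) = cox_gen W' s) ->
        f =1 edge_erasing W' E].
Proof.
split; first exact: erasing_compressive.
  by move=> s; apply: erasing_gen.
move=> f [f_hom f_surj _ _] f_gen w.
(* On each component, [f(w)_J = f(w_J) = theta_J(w_J)], which is also the [J]-part of the image of
   [w] under edge erasing. *)
apply: (comp_part_eq W'_laced W'_diagram) => J.
have same_m := comp_same_m W_laced W'_laced W'_diagram (J := J).
rewrite (erasing_part W_laced W'_laced W'_diagram) -(hom_part f_hom f_surj f_gen).
apply: (hom_transfer W_laced W'_laced same_m f_hom f_surj f_gen).
exact: parabolic_part_in.
Qed.
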